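(* Let $d\ge 1$, $p\in[1,\infty)$, and let $\mu$ be a Borel probability measure on $\mathbb{R}^d$ such that $M_s(\mu)<\infty$ for some $s>2p$. Let $X_1,\dots,X_n$ be i.i.d. with law $\mu$ and $\mu_n=\frac1n\sum_{j=1}^n\delta_{X_j}$. Then there is a constant $c>0$ depending only on $p$ and $s$ such that for all $\epsilon>0$, $$\mathbb{P}\left( \overline{\mathcal{W}}_p(\mu_n, \mu)^p \ge c\log(2n+1)^{\frac{p}{s}} \left[\sqrt{\frac{d}{n}} +\left(1+\sqrt{M_{s}(\mu) \vee M_{s}(\mu_n)}\right)\epsilon \right]\right)\le e^{-\frac{n\epsilon^2}{2}}+ 8e^{\log(2n+1)\left[2(d+1)-\frac{n\epsilon^2}{64}\right]}.$$
   Context: $\mathbb{R}^d$ carries the Euclidean inner product $\langle\cdot,\cdot\rangle$ and norm $|\cdot|$. For a probability measure $\nu$ and $q\ge1$, $M_q(\nu)=\int|x|^q\,\nu(dx)$. For a unit vector $\theta$, $\nu_\theta$ denotes the pushforward of $\nu$ under $x\mapsto\langle x,\theta\rangle$. For probability measures $\alpha,\beta$ on $\mathbb{R}$, $\mathcal{W}_p(\alpha,\beta)^p=\inf_{\pi\in\Pi(\alpha,\beta)}\int|x-y|^p\,\pi(dx,dy)$, where $\Pi(\alpha,\beta)$ is the set of couplings. The max-sliced Wasserstein distance is $\overline{\mathcal{W}}_p(\mu,\nu)=\sup_{|\theta|=1}\mathcal{W}_p(\mu_\theta,\nu_\theta)$. *)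

(* Defs.v *)
From HB Require Import structures.
From mathcomp Require Import all_boot all_order all_algebra.
From mathcomp Require Import all_classical all_reals all_analysis.
Set Implicit Arguments. Unset Strict Implicit. Unset Printing Implicit Defensive.
Import Order.TTheory GRing.Theory Num.Theory.
Import numFieldNormedType.Exports.
Local Open Scope classical_set_scope.
Local Open Scope ring_scope.

Section defs.
Variable R : realType.

(* R^d is modelled as d.-tuple R with its product (= Borel) sigma-algebra *)
Definition dotp (d : nat) (x y : d.-tuple R) : R := \sum_(i < d) tnth x i * tnth y i.
Definition enorm (d : nat) (x : d.-tuple R) : R := Num.sqrt (dotp x x).

Definition moment (d : nat) (nu : {measure set (d.-tuple R) -> \bar R}) (q : R) : \bar R :=
  (\int[nu]_x (enorm x `^ q)%:E)%E.

Definition empirical (d : nat) (pts : nat -> d.-tuple R) (n : nat)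
  : {measure set (d.-tuple R) -> \bar R} :=
  mscale ((n%:R : R)^-1)%:nng
         (msum (fun k => [the measure _ _ of \d_(pts k)]) n).

Definition proj (d : nat) (nu : set (d.-tuple R) -> \bar R) (theta : d.-tuple R)
  : set R -> \bar R := pushforward nu (fun x => dotp x theta).

Definition coupling (alpha beta : set R -> \bar R) (pi : probability (R * R)%type R) : Prop :=
  forall A : set R, measurable A ->
    pi (A `*` setT) = alpha A /\ pi (setT `*` A) = beta A.

Definition Wp (p : R) (alpha beta : set R -> \bar R) : \bar R :=
  (ereal_inf [set (\int[pi]_z (`|z.1 - z.2| `^ p)%:E)%E | pi in coupling alpha beta]
   `^ p^-1)%E.

Definition maxslicedWp (d : nat) (p : R) (mu nu : set (d.-tuple R) -> \bar R) : \bar R :=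
  ereal_sup [set Wp p (proj mu theta) (proj nu theta) | theta in [set t | enorm t = 1]].

Definition mutually_independent dO (Omega : measurableType dO) (P : probability Omega R)
  (d n : nat) (X : nat -> Omega -> d.-tuple R) : Prop :=
  forall B : nat -> set (d.-tuple R), (forall j, (j < n)%N -> measurable (B j)) ->
    P (\bigcap_(j in [set j | (j < n)%N]) (X j @^-1` B j)) =
    (\prod_(j < n) P (X j @^-1` B j))%E.

End defs.

(* Main.v *)
Require Import Defs.
From HB Require Import structures.
From mathcomp Require Import all_boot all_order all_algebra.
From mathcomp Require Import all_classical all_reals all_analysis.
From mathcomp Require Import measurable_realfun lra ring.
Import Order.TTheory GRing.Theory Num.Theory.
Import numFieldNormedType.Exports.
Local Open Scope classical_set_scope.
Local Open Scope ring_scope.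

(* The quantile coupling bounds the p-th power of the Wasserstein distance on the
   line by [4^p] times the integral of [(1 + |t|)^(p-1)] against the difference
   of the distribution functions, which turns the problem into a weighted L1
   bound for an empirical process indexed by half-spaces.  This process is
   chained over grids of mesh [4^-k / sqrt d] approximating the direction.  Each
   increment is a sum of variables with values in {-1, 0, 1}, so
   [expR (x - x^2) <= 1 + x + x^2] yields a self-normalised exponential moment
   bound; integrating it against [(1 + |t|)^(-1-a)] controls all
   thresholds [t] simultaneously, and the bracket, weighted by
   [(1 + |t|)^(q-1)] with [2p < q < s], integrates to a q-th moment times the
   length of the increment.  The random size of the moments is dealt with by
   peeling over their integer logarithm [j].  The resulting probability bound is
   [expR (- n * eps^2 / 2)] as soon as [128 (d + 1) <= n * eps^2]; otherwise the
   right-hand side of the theorem is at least 8. *)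

(** * Polynomially weighted lengths of intervals on the line *)

Section interval_weights.
Context {R : realType}.
Notation leb := (@lebesgue_measure R).

(** The bracket contains the empirical part as well as its mean, so unbounded laws need no
    truncation: heavy tails enter only through moments of [mu] and of the sample, in the form in
    which the theorem displays them. The gap between [2 * p] and [s] is spent twice. Squaring the
    tilt [wt (p + a)] against the integrable weight [wt (- 1 - a)] gives the exponent [q - 1] with
    [q = 2 * p + a], so moments slightly above [2 * p] are unavoidable here. Then [tau = q / s < 1]
    leaves a spare exponential in [j] that absorbs the factor [j.+1] which peeling costs; what
    remains is [expR (j / 2)], the square root of the s-th moments. The ratio 4 between grids works
    in the same way: the bracket of a link shrinks like [4 ^- k] while the entropy grows linearly in
    [k], and a rate proportional to [2 ^+ k] turns both into the summable [k.+1 * 2 ^- k]. Since the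
    moments of the sample are random, the good event is required for all slices [j] at once, and the
    slice is chosen only after the sample is fixed. *)

Definition below (a t : R) : R := (a <= t)%R%:R.

Definition wt (r t : R) : R := (1 + `|t|) `^ r.

Lemma wt_ge0 r t : 0 <= wt r t.
Proof. exact: powR_ge0. Qed.

Lemma measurable_wt r : measurable_fun setT (wt r).
Proof.
apply: (measurableT_comp (measurable_powR _)) => //.
by apply: measurable_funD => //; exact: measurableT_comp.
Qed.

Lemma wtD r r' t : wt (r + r') t = wt r t * wt r' t.
Proof. by rewrite /wt powRD//; apply/implyP => _; rewrite gt_eqF// ltr_pwDl. Qed.

(** [below a] is the distribution function of the point mass at [a], so a difference of two of them
    is carried by an interval. *)
Lemma below_dist a b t :
  `|below a t - below b t| = (t \in `[Order.min a b, Order.max a b[%R)%:R.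
Proof.
rewrite /below in_itv/=; case: (leP a b) => ab; case: (leP a t) => ha; case: (leP b t) => hb => /=;
 rewrite ?subrr ?normr0 ?subr0 ?sub0r ?normrN ?normr1//.
- by have := lt_le_trans (lt_le_trans ha ab) hb; rewrite ltxx.
- by have := lt_trans (le_lt_trans ha hb) ab; rewrite ltxx.
Qed.

Lemma integral_wt_between r a b : 
  (\int[leb]_t (wt r t * `|below a t - below b t|)%:E =
  \int[leb]_(t in `[Order.min a b, Order.max a b[) (wt r t)%:E)%E.
Proof.
rewrite [RHS]integral_mkcond/=; apply: eq_integral => t _.
rewrite patchE below_dist mem_setE; case: ifP => /= _; by rewrite ?mulr1 ?mulr0.
Qed.

(** Length times the largest weight; with [r = q - 1] this is how the bracket becomes a q-th
    moment. *)
Lemma integral_wt_le r a b c : 0 <= r -> `|a| <= c -> `|b| <= c ->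
  (\int[leb]_t (wt r t * `|below a t - below b t|)%:E <=
    (`|a - b| * (1 + c) `^ r)%:E)%E.
Proof.
move=> r0 ac bc; rewrite integral_wt_between.
have mM : Order.min a b <= Order.max a b by rewrite ge_min !le_max lexx.
have c0 : 0 <= c by apply: le_trans ac.
apply: (@le_trans _ _ (\int[leb]_(t in `[Order.min a b, Order.max a b[) ((1 + c) `^ r)%:E)%E).
  apply: ge0_le_integral => //.
  - by move=> x _; rewrite lee_fin wt_ge0.
  - apply/measurable_EFinP; apply: measurable_funTS; exact: measurable_wt.
  - move=> x /=; rewrite in_itv/= => /andP[h1 h2]; rewrite lee_fin /wt.
    apply: ge0_ler_powR => //; rewrite ?nnegrE ?addr_ge0//.
    rewrite lerD2l ler_norml; move: ac bc; rewrite !ler_norml => /andP[a1 a2] /andP[b1 b2].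
    apply/andP; split.
      by apply: le_trans h1; rewrite le_min a1.
    by apply: (le_trans (ltW h2)); rewrite ge_max a2.
rewrite integral_cst//= lebesgue_measure_itv/= lte_fin -EFinD.
case: ifP => h; last by rewrite mule0 lee_fin mulr_ge0// powR_ge0.
rewrite -EFinM lee_fin mulrC ler_wpM2r ?powR_ge0//.
case: (leP a b) => ab; first by rewrite distrC ger0_norm ?subr_ge0.
by rewrite ger0_norm ?subr_ge0// ltW.
Qed.

(** Cut the interval between [a] and [b] into quarters of length [h]. The quarter at the end
    pointing away from the origin, decided by the sign of the midpoint, keeps distance at least [h]
    from 0, so the weight there is at least the power [p - 1] of [h]. This is the origin of the
    constant 4. *)
Lemma powR_dist_le p a b : 1 <= p ->
  ((`|a - b| `^ p)%:E <=
   (4 `^ p)%:E * \int[leb]_t (wt (p - 1) t * `|below a t - below b t|)%:E)%E.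
Proof.
move=> p1; rewrite integral_wt_between.
set m := Order.min a b; set M := Order.max a b.
have mM : m <= M by rewrite /m /M ge_min !le_max lexx.
have -> : `|a - b| = M - m.
  rewrite /m /M; case: (leP a b) => ab; first by rewrite distrC ger0_norm ?subr_ge0.
  by rewrite ger0_norm ?subr_ge0// ltW.
have p0 : 0 < p by apply: lt_le_trans p1.
set h := (M - m) / 4.
have h0 : 0 <= h by rewrite divr_ge0// subr_ge0.
have -> : M - m = 4 * h by rewrite /h mulrC divfK.
rewrite powRM//  EFinM lee_wpmul2l ?lee_fin ?powR_ge0//.
have key I : measurable I -> I `<=` `[m, M[%classic -> (forall y, \int[leb]_(t in I) y%:E = y%:E * h%:E)%E -> 
    (forall t, I t -> h <= `|t|) -> ((h `^ p)%:E <= \int[leb]_(t in `[m, M[) (wt (p - 1) t)%:E)%E.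
  move=> mI sI lI hI.
  apply: (@le_trans _ _ (\int[leb]_(t in I) (wt (p - 1) t)%:E)%E); last first.
    apply: ge0_subset_integral => //=.
    - apply/measurable_EFinP; apply: measurable_funTS; exact: measurable_wt.
    - by move=> x _; rewrite lee_fin wt_ge0.
  apply: (@le_trans _ _ (\int[leb]_(t in I) (h `^ (p - 1))%:E)%E).
    rewrite lI -EFinM lee_fin.
    move: h0; rewrite le_eqVlt => /predU1P[<-|h0]; first by rewrite powR0 ?gt_eqF// mulr0.
    rewrite -{3}(powRr1 (ltW h0)) -powRD ?subrK//.
    by apply/implyP => _; rewrite gt_eqF.
  apply: ge0_le_integral => //.
  - by move=> x _; rewrite lee_fin powR_ge0.
  - apply/measurable_EFinP; apply: measurable_funTS; exact: measurable_wt.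
  - move=> x /hI hx; rewrite lee_fin /wt ge0_ler_powR ?subr_ge0 ?nnegrE ?addr_ge0//.
    by rewrite (le_trans hx)// lerDr.
have e3 : M = m + 4 * h by rewrite /h; field.
have [m0|m0] := leP 0 (m + 2 * h).
- apply: (key `[m + 3 * h, M[%classic) => //.
  + by move=> x /=; rewrite !in_itv/= => /andP[h1 ->]; rewrite andbT; lra.
  + move=> y; rewrite integral_cst//= lebesgue_measure_itv/= lte_fin -EFinD; case: ifPn => [_|]; first by congr (_ * EFin _)%E; lra.
    by rewrite -leNgt => hh; congr (_ * EFin _)%E; lra.
  + move=> x /=; rewrite in_itv/= => /andP[h1 h2].
    by rewrite ler_normr; apply/orP; left; lra.
- apply: (key `[m, m + h[%classic) => //.
  + by move=> x /=; rewrite !in_itv/= => /andP[h1 h2]; apply/andP; split; lra.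
  + move=> y; rewrite integral_cst//= lebesgue_measure_itv/= lte_fin -EFinD; case: ifPn => [_|]; first by congr (_ * EFin _)%E; lra.
    by rewrite -leNgt => hh; congr (_ * EFin _)%E; lra.
  + move=> x /=; rewrite in_itv/= => /andP[h1 h2].
    by rewrite ler_normr; apply/orP; right; lra.
Qed.

Lemma powR_mulr (c r : R) : 0 < c -> c * c `^ (r - 1) = c `^ r.
Proof.
move=> c0; rewrite -{1}(powRr1 (ltW c0)) -powRD; first by congr powR; ring.
by apply/implyP => _; rewrite gt_eqF.
Qed.

Lemma integral_wt_bounded (a : R) : 0 < a ->
  exists2 I : R, 1 <= I & (\int[leb]_t (wt (- 1 - a) t)%:E <= I%:E)%E.
Proof.
move=> a0; pose g t : R := (1 + t) `^ (- 1 - a); pose G t : R := - a^-1 * (1 + t) `^ (- a).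
have dpow (r t : R) : 0 <= t -> is_derive t (1 : R) (fun u : R => (1 + u) `^ r) (r * (1 + t) `^ (r - 1)).
  move=> t0; have p0 : 0 < 1 + t by rewrite ltr_pwDl.
  have d1 : is_derive t (1 : R) (fun u : R => 1 + u) 1.
    by rewrite -[X in is_derive _ _ _ X]add0r; apply: is_deriveD.
  have d2 := @is_derive1_comp _ (fun u : R => u `^ r) (fun u : R => 1 + u) t _ _ (is_derive1_powR _ p0) d1.
  by apply: is_derive_eq; rewrite /= mulr1.
have cpow (r t : R) : 0 <= t -> {for t, continuous (fun u : R => (1 + u) `^ r)}.
  move=> t0; have [d _] := dpow r t t0.
  by apply: differentiable_continuous; exact/derivable1_diffP.
have dG (t : R) : 0 <= t -> is_derive t (1 : R) G (g t).
  move=> t0; have d1 := dpow (- a) t t0.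
  have d2 : is_derive t (1 : R) G (- a^-1 * (- a * (1 + t) `^ (- a - 1))).
    by apply: is_deriveZ.
  apply: is_derive_eq; rewrite /g mulrA mulrNN mulVf ?gt_eqF// mul1r.
  by congr powR; ring.
have cG : G x @[x --> +oo] --> 0.
  rewrite /G -[X in _ --> X](mulr0 (- a^-1)); apply: cvgMr.
  apply/cvgrPdist_lt => e e0; exists (e `^ (- a^-1)); split; first exact: num_real.
  move=> t te; rewrite sub0r normrN ger0_norm ?powR_ge0//.
  have e1 : 0 < e `^ (- a^-1) by rewrite powR_gt0.
  have t0 : 0 < 1 + t by lra.
  have -> : e = (e `^ (- a^-1)) `^ (- a) by rewrite -powRrM mulrNN mulVf ?gt_eqF// powRr1// ltW.
  move: te e1; set m := e `^ _ => te m0.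
  rewrite !powRN ltf_pV2 ?posrE ?powR_gt0//.
  have mt : m < 1 + t by lra.
  by apply: gt0_ltr_powR; rewrite // nnegrE ltW.
have h : (\int[leb]_(t in `[0%R, +oo[) (g t)%:E = a^-1%:E)%E.
  rewrite (@ge0_continuous_FTC2y _ g G 0 0)//.
  - by rewrite /G addr0 powR1 mulr1 EFinN oppeK add0e.
  - by move=> x x0; exact: powR_ge0.
  - apply/continuous_within_itvcyP; split.
      by move=> x; rewrite in_itv/= andbT => x0; apply: cpow; exact: ltW.
    by apply: cvg_at_right_filter; exact: cpow.
  - by move=> x x0; have [] := dG x (ltW x0).
  - apply: cvg_at_right_filter; apply: cvgMr; exact: cpow.
  - move=> x; rewrite in_itv/= andbT => x0; rewrite derive1E.
    by have [_ ->] := dG x (ltW x0).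
(* Each half-line contributes [a^-1]; the extra 1 secures [1 <= I], which later keeps the thresholds
   above 1 and their logarithms nonnegative. *)
exists (1 + 2 * a^-1); first by rewrite lerDl mulr_ge0// invr_ge0 ltW.
have mw : measurable_fun (setT : set R) (fun t => (wt (-1 - a) t)%:E).
  by apply/measurable_EFinP; exact: measurable_wt.
have w0 t : (0 <= (wt (-1 - a) t)%:E)%E by rewrite lee_fin wt_ge0.
have e : (\int[leb]_(t in `[0%R, +oo[) (wt (- 1 - a) t)%:E = a^-1%:E)%E.
  rewrite -h; apply: eq_integral => t; rewrite inE/= in_itv/= andbT => t0.
  by rewrite /wt ger0_norm.
have e' := ge0_integration_by_substitution0 mw w0.
rewrite e in e'.
have <- : `]-oo, 0%R] `|` `]0%R, +oo[ = [set: R] :> set R.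
  by apply/seteqP; split => // t _ /=; rewrite !in_itv/= andbT; case: (leP t 0) => ?; [left|right].
rewrite ge0_integral_setU//=; last 2 first.
- exact: measurable_funTS.
- apply/disj_setPS => t /=; rewrite !in_itv/= andbT => -[t1 t2].
  by have := lt_le_trans t2 t1; rewrite ltxx.
rewrite integral_itv_obnd_cbnd ?e; last exact: measurable_funTS.
have -> : (\int[leb]_(t in `]-oo, 0%R]) (wt (-1 - a) t)%:E = a^-1%:E)%E.
  by rewrite [RHS]e'; apply: eq_integral => t _; rewrite /wt normrN.
by rewrite -EFinD lee_fin; lra.
Qed.

End interval_weights.

(** * Quantile coupling of two laws on the line *)

Section quantile_coupling.
Context {R : realType}.
Notation leb := (@lebesgue_measure R).
Local Open Scope measure_display_scope.

(** A law on the line is the law of the identity, which makes the theory of [cdf] for random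
    variables applicable. *)
Let idR : measurableTypeR R -> R := idfun.

#[local] HB.instance Definition _ :=
  @isMeasurableFun.Build _ _ _ _ idR (@measurable_id _ _ setT).

Definition cdfR (P : set R -> \bar R) (t : R) : R := fine (P `]-oo, t]%classic).

Section one_law.
Variable P : probability (measurableTypeR R) R.
Notation F := (cdfR P).

Lemma cdfRE t : cdfR P t = fine (cdf (idR : {RV P >-> R}) t).
Proof. by rewrite /cdf /distribution /pushforward/= preimage_id. Qed.

Lemma cdfR_nd : nondecreasing F.
Proof.
move=> x y xy; rewrite !cdfRE fine_le ?fin_num_measure//.
exact: cdf_nondecreasing.
Qed.

Lemma cdfR_ge0 t : 0 <= F t. Proof. by rewrite fine_ge0. Qed.

Lemma cdfR_le1 t : F t <= 1.
Proof. by rewrite -lee_fin fineK ?fin_num_measure// probability_le1. Qed.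

Lemma cdfR_rc : right_continuous F.
Proof.
move=> a.
have -> : F = fine \o cdf (idR : {RV P >-> R}) by apply/funext => t; rewrite cdfRE.
apply: fine_cvg => /=.
by rewrite fineK ?fin_num_measure//; exact: cdf_right_continuous.
Qed.

Lemma cdfR_cvgy : F @ +oo --> (1 : R).
Proof.
have -> : F = fine \o cdf (idR : {RV P >-> R}) by apply/funext => t; rewrite cdfRE.
exact/fine_cvg/cvg_cdfy1.
Qed.

Lemma cdfR_cvgNy : F @ -oo --> (0 : R).
Proof.
have -> : F = fine \o cdf (idR : {RV P >-> R}) by apply/funext => t; rewrite cdfRE.
exact/fine_cvg/cvg_cdfNy0.
Qed.

Definition quantile (u : R) : R := inf [set t | u <= F t].

(** The limits of [F] at both infinities make the set nonempty and bounded below for such [u]; right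
    continuity shows that its infimum belongs to it. *)
Lemma quantile_le u t : 0 < u < 1 -> (quantile u <= t) = (u <= F t).
Proof.
move=> /andP[u0 u1].
have S0 : [set t | u <= F t] !=set0.
  have : \forall x \near +oo, u < F x by exact: (cvgr_gt 1 cdfR_cvgy).
  case=> M [_ hM]; exists (M + 1) => /=; apply/ltW/hM; lra.
have Sb : has_lbound [set t | u <= F t].
  have : \forall x \near -oo, F x < u by exact: (cvgr_lt 0 cdfR_cvgNy).
  case=> M [_ hM]; exists (M - 1) => x /= ux; rewrite leNgt; apply/negP => xM.
  have := hM x ltac:(lra); lra.
apply/idP/idP => [qt|ut]; last exact: ge_inf.
apply: (@le_trans _ _ (F (quantile u))); last exact: cdfR_nd.
rewrite leNgt; apply/negP => Fq.
have : \forall x \near (quantile u)^'+, F x < u by exact: (cvgr_lt _ (@cdfR_rc _) u Fq).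
case=> e /= e0 he.
have [s /= us sq] : exists2 s, [set t | u <= F t] s & s < quantile u + e.
  by apply: inf_adherent => //; split.
have qs : quantile u <= s by exact: ge_inf.
move: qs; rewrite le_eqVlt => /predU1P[qs|qs]; first by rewrite qs in Fq; lra.
have := he s; rewrite /ball/= => /(_ _ qs); rewrite ltr_norml => /(_ ltac:(apply/andP; split; lra)); lra.
Qed.

Lemma measurable_quantile : measurable_fun (`]0, 1[%classic : set (measurableTypeR R)) quantile.
Proof.
apply: (measurability _ (RGenOInfty.measurableE R)) => _ [_ [t ->] <-].
have -> : `]0, 1[%classic `&` quantile @^-1` `]t, +oo[%classic = 
   `]0, 1[%classic `&` `](F t), +oo[%classic.
  apply/seteqP; split => u /=; rewrite !in_itv/= !andbT => -[h].
    by rewrite ltNge quantile_le// -ltNge.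
  by move=> uF; split => //; rewrite ltNge quantile_le// -ltNge.
by apply: measurableI.
Qed.

End one_law.

Lemma probability_cdfR_unique (P1 P2 : probability (measurableTypeR R) R) :
  (forall t, P1 `]-oo, t]%classic = P2 `]-oo, t]%classic) -> forall A, measurable A -> P1 A = P2 A.
Proof.
move=> h A mA; apply: (@measure_unique _ R (measurableTypeR R) (@ocitv R) (fun k => `]-(k%:R), k%:R]%classic)) => //.
- exact: ocitvI.
- move=> i; exact: is_ocitv.
- rewrite -subTset => x _; exists (Num.truncn `|x|).+1 => //=.
  rewrite in_itv/=; have := truncnS_gt `|x|; rewrite ltr_norml => /andP[h1 h2].
  by rewrite h1 ltW.
- move=> _ [[a b] _ <-] /=.
  have [ab|ba] := leP a b; last by rewrite set_itv_ge ?measure0// bnd_simp -leNgt ltW.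
  have -> : `]a, b]%classic = `]-oo, b] `\` `]-oo, a].
    by rewrite -[RHS]setCK setCD setCitvl setUC -[LHS]setCK setCitv.
  rewrite !measureD//= ?setIidr//=; try exact: subset_itvl.
  + by rewrite !h.
  + by rewrite -ge0_fin_numE// fin_num_measure.
  + by rewrite -ge0_fin_numE// fin_num_measure.
- move=> k; by rewrite -ge0_fin_numE// fin_num_measure.
Qed.

Definition unif01 : set (measurableTypeR R) -> \bar R :=
  mrestr leb (@measurable_itv R `]0, 1[).

HB.instance Definition _ := Measure.on unif01.

Let unif01T : unif01 setT = 1%E.
Proof.
by rewrite /unif01 /mrestr/= setTI lebesgue_measure_itv/= lte01 EFinN sube0.
Qed.

HB.instance Definition _ := @Measure_isProbability.Build _ _ R unif01 unif01T.

Lemma unif01_le x : 0 <= x <= 1 -> unif01 `]-oo, x]%classic = x%:E.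
Proof.
move=> /andP[x0 x1]; rewrite /unif01 /mrestr.
have [x1'|x1'] := ltP x 1.
  have -> : `]-oo, x]%classic `&` `]0, 1[%classic = `]0, x]%classic :> set R.
    apply/seteqP; split => u /=; rewrite !in_itv/=; lra.
  rewrite lebesgue_measure_itv/= lte_fin; case: ifPn => h; first by rewrite EFinN sube0.
  by congr EFin; lra.
have -> : x = 1 by lra.
have -> : `]-oo, 1%R]%classic `&` `]0, 1[%classic = `]0, 1[%classic :> set R.
  apply/seteqP; split => u /=; rewrite !in_itv/=; lra.
by rewrite lebesgue_measure_itv/= lte01 EFinN sube0.
Qed.

Lemma measurable_below2 d (T : measurableType d) (f g : T -> R) : 
  measurable_fun setT f -> measurable_fun setT g -> 
  measurable_fun setT (fun x => below (f x) (g x)).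
Proof.
move=> mf mg.
have -> : (fun x => below (f x) (g x)) = (fun x => if (f x <= g x)%R then 1 else 0 : R).
  by apply/funext => x; rewrite /below; case: (f x <= g x)%R.
by apply: measurable_fun_ifT => //; exact: measurable_fun_ler.
Qed.

Lemma measurable_dist_below d (T : measurableType d) (f f' g : T -> R) :
  measurable_fun setT f -> measurable_fun setT f' -> measurable_fun setT g -> 
  measurable_fun setT (fun x => `|below (f x) (g x) - below (f' x) (g x)|).
Proof.
move=> mf mf' mg; apply: measurableT_comp => //.
by apply: measurable_funB; exact: measurable_below2.
Qed.

(** The default value 0 outside []0, 1[], a null set for [unif01], makes the quantile function total
    and measurable. *)
Let q (P : probability (measurableTypeR R) R) : measurableTypeR R -> R :=
  quantile P \_ `]0, 1[%classic.

Let mq P : measurable_fun setT (q P).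
Proof.
have mI : measurable (`]0, 1[%classic : set (measurableTypeR R)) by exact: measurable_itv.
exact: (measurable_restrictT (quantile P) mI).1 (measurable_quantile P).
Qed.

Let qE P u t : 0 < u < 1 -> (q P u <= t) = (u <= cdfR P t).
Proof.
by move=> u01; rewrite /q patchE mem_setE in_itv/= u01 quantile_le.
Qed.

Let q_law P t : unif01 (q P @^-1` `]-oo, t]%classic) = P `]-oo, t]%classic.
Proof.
transitivity (unif01 `]-oo, (cdfR P t)]%classic); last first.
  by rewrite unif01_le ?cdfR_ge0 ?cdfR_le1// /cdfR fineK// fin_num_measure.
rewrite /unif01 /mrestr; congr (leb _).
apply/seteqP; split => u /=; rewrite !in_itv/= => -[h u01]; split => //; by move: h; rewrite qE.
Qed.

(** Under the common uniform variable the events that a quantile is at most [t] are nested intervals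
    ending at the two values of the distribution functions, so their symmetric difference has the
    length claimed. *)
Let q_between P1 P2 t : 
  (\int[unif01]_u (`|below (q P1 u) t - below (q P2 u) t|)%:E = 
   `|cdfR P1 t - cdfR P2 t|%:E)%E.
Proof.
wlog le12 : P1 P2 / cdfR P1 t <= cdfR P2 t.
  move=> h; have [/h//|/ltW/h] := leP (cdfR P1 t) (cdfR P2 t).
  rewrite distrC => <-; apply: eq_integral => u _; by rewrite distrC.
pose A (P : probability (measurableTypeR R) R) : set (measurableTypeR R) := q P @^-1` `]-oo, t]%classic.
have mA P : measurable (A P).
  by rewrite /A -[X in measurable X]setTI; apply: mq => //; exact: measurable_itv.
have mD : measurable ((A P2 `\` A P1) `|` (A P1 `\` A P2)).
  by apply: measurableU; apply: measurableD.
have e u : `|below (q P1 u) t - below (q P2 u) t| = \1_((A P2 `\` A P1) `|` (A P1 `\` A P2)) u.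
  have memA P : (u \in A P) = (q P u <= t).
    by apply/idP/idP; rewrite inE /A/= in_itv.
  rewrite indicE in_setU !in_setD !memA /below.
  case: (q P1 u <= t); case: (q P2 u <= t) => /=;
    by rewrite ?subrr ?normr0 ?subr0 ?sub0r ?normrN ?normr1.
under eq_integral do rewrite e.
rewrite integral_indic// setIT.
rewrite distrC ger0_norm ?subr_ge0// EFinB.
rewrite -!unif01_le ?cdfR_ge0 ?cdfR_le1//.
have -> : (unif01 `]-oo, (cdfR P2 t)]%classic - unif01 `]-oo, (cdfR P1 t)]%classic =
    unif01 (`]-oo, (cdfR P2 t)]%classic `\` `]-oo, (cdfR P1 t)]%classic))%E.
  rewrite measureD// ?setIidr//; first exact: subset_itvl.
  by rewrite -ge0_fin_numE// fin_num_measure.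
rewrite /unif01 /mrestr; congr (leb _).
apply/seteqP; split => u /=; rewrite /A/= !in_itv/= => -[h u01]; split => //; move: h; rewrite !qE//.
  by move=> [//|[h1 h2]]; exfalso; apply: h2; exact: le_trans le12.
by left.
Qed.

Lemma measurable_cdfR (P : probability (measurableTypeR R) R) :
  measurable_fun (setT : set (measurableTypeR R)) (cdfR P).
Proof. apply: nondecreasing_measurable => //; exact: cdfR_nd. Qed.

(** Integrate [powR_dist_le] along the quantile coupling and exchange the two integrals; [q_between]
    evaluates the inner one. *)
Lemma transport_cost_le_cdf p (P1 P2 : probability (measurableTypeR R) R) : 1 <= p ->
  exists2 pi : probability (R * R)%type R, coupling P1 P2 pi &
  (\int[pi]_z (`|z.1 - z.2| `^ p)%:E <=
    (4 `^ p)%:E * \int[leb]_t (wt (p - 1) t * `|cdfR P1 t - cdfR P2 t|)%:E)%E.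
Proof.
move=> p1.
pose Q (u : measurableTypeR R) : R * R := (q P1 u, q P2 u).
have mQ : measurable_fun setT Q by apply: measurable_fun_pair; exact: mq.
pose QM : {RV unif01 >-> (R * R)%type} := HB.pack Q (isMeasurableFun.Build _ _ _ _ _ mQ).
exists (distribution unif01 QM).
  move=> A mA; rewrite /distribution /pushforward.
  pose qM P : {RV unif01 >-> measurableTypeR R} :=
    HB.pack (q P) (isMeasurableFun.Build _ _ (measurableTypeR R) (measurableTypeR R) _ (mq P)).
  have h P : unif01 (q P @^-1` A) = P A.
    exact: (@probability_cdfR_unique (distribution unif01 (qM P)) P (q_law P)).
  rewrite -!h; split; congr (unif01 _).
    by apply/seteqP; split => u //= [].
  by apply/seteqP; split => u //= [].
rewrite ge0_integral_distribution//; last first.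
  apply/measurable_EFinP; apply: (measurableT_comp (measurable_powR _)) => //.
  apply: measurableT_comp => //; apply: measurable_funB => //.
pose g (z : measurableTypeR R * measurableTypeR R) : \bar R := 
  (wt (p - 1) z.2 * `|below (q P1 z.1) z.2 - below (q P2 z.1) z.2|)%:E.
have g0 z : (0 <= g z)%E by rewrite lee_fin mulr_ge0// wt_ge0.
have mg : measurable_fun setT g.
  apply/measurable_EFinP; apply: measurable_funM.
    by apply: measurableT_comp; [exact: measurable_wt|exact: measurable_snd].
  apply: (@measurable_dist_below _ _ (fun z => q P1 z.1) (fun z => q P2 z.1) snd).
  - by apply: measurableT_comp => //; exact: mq.
  - by apply: measurableT_comp => //; exact: mq.
  - exact: measurable_snd.
have mG : measurable_fun setT (fun u : measurableTypeR R => \int[leb]_t g (u, t))%E.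
  exact: (measurable_fun_fubini_tonelli_F (m2 := leb) g mg g0).
apply: (@le_trans _ _ (\int[unif01]_u ((4 `^ p)%:E * \int[leb]_t g (u, t))))%E.
  apply: ge0_le_integral => //=.
  - apply/measurable_EFinP; apply: (measurableT_comp (measurable_powR _)) => //.
    by apply: measurableT_comp => //; apply: measurable_funB => //; exact: mq.
  - exact: measurable_funeM.
  - by move=> u _; exact: powR_dist_le.
rewrite ge0_integralZl//; last first.
  by move=> u _; apply: integral_ge0.
rewrite lee_wpmul2l ?lee_fin ?powR_ge0//.
rewrite (fubini_tonelli (m1 := unif01) (m2 := leb) g)//.
apply: ge0_le_integral => //=.
- by move=> t _; apply: integral_ge0.
- exact: (measurable_fun_fubini_tonelli_G (m1 := unif01) g mg g0).
- apply/measurable_EFinP; apply: measurable_funM; first exact: measurable_wt.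
  by apply: measurableT_comp => //; apply: measurable_funB; exact: measurable_cdfR.
move=> t _; rewrite /g/=.
under eq_integral do rewrite EFinM.
rewrite ge0_integralZl//.
- by rewrite q_between EFinM.
- apply/measurable_EFinP.
  by apply: (@measurable_dist_below _ _ (q P1) (q P2) (cst t)) => //; exact: mq.
- by rewrite lee_fin wt_ge0.
Qed.

End quantile_coupling.

(** * Self-normalised exponential moments for increments of the empirical process *)

Section iid_sample.
Context {R : realType} dO (Omega : measurableType dO) (P : probability Omega R).
Context dT (T : measurableType dT) (mu : probability T R).
Variables (n : nat) (X : nat -> Omega -> T).
Hypothesis mX : forall j, (j < n)%N -> measurable_fun setT (X j).
Hypothesis lawX : forall j, (j < n)%N -> forall B, measurable B -> P (X j @^-1` B) = mu B.
Hypothesis indepX : forall B : nat -> set T, (forall j, (j < n)%N -> measurable (B j)) ->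
  P (\bigcap_(j in [set j | (j < n)%N]) (X j @^-1` B j)) =
    (\prod_(j < n) P (X j @^-1` B j))%E.

Lemma integral_finite_valued (K : finType) (k : T -> K) (c : K -> R) :
  (forall a, measurable (k @^-1` [set a])) -> (forall a, 0 <= c a) ->
  (\int[mu]_x (c (k x))%:E = (\sum_a c a * fine (mu (k @^-1` [set a])))%:E)%E.
Proof.
move=> mk c0.
transitivity (\int[mu]_x (\sum_a (c a * \1_(k @^-1` [set a]) x)%:E))%E.
  apply: eq_integral => x _; rewrite sumEFin (bigD1 (k x))//= big1 ?addr0.
    by rewrite indicE mem_set// mulr1.
  by move=> a ak; rewrite indicE memNset ?mulr0//= => /esym/eqP; exact/negP.
rewrite ge0_integral_sum//; last 2 first.
- by move=> a; apply/measurable_EFinP; apply: measurable_funM => //; exact: measurable_indic.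
- by move=> a x _; rewrite lee_fin mulr_ge0.
rewrite -sumEFin; apply: eq_bigr => a _.
under eq_integral do rewrite EFinM.
rewrite ge0_integralZl//.
- by rewrite integral_indic// setIT EFinM fineK// fin_num_measure.
- by apply/measurable_EFinP; exact: measurable_indic.
- by rewrite lee_fin.
Qed.

(** Independence is available only for rectangles, so the product is expanded over all assignments
    [h] of values to the sample points; each term is a multiple of the indicator of a rectangle. *)
Lemma integral_prod_finite_valued (K : finType) (k : T -> K) (c : K -> R) :
  (forall a, measurable (k @^-1` [set a])) -> (forall a, 0 <= c a) ->
  (\int[P]_w (\prod_(i < n) c (k (X i w)))%:E =
   ((\sum_a c a * fine (mu (k @^-1` [set a]))) ^+ n)%:E)%E.
Proof.
move=> mk c0.
(* [indepX] expects a family indexed by all naturals; [setT] fills the indices beyond the sample. *)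
pose B (h : {ffun 'I_n -> K}) (j : nat) : set T :=
  if insub j is Some i then k @^-1` [set h i] else setT.
have BE h (i : 'I_n) : B h i = k @^-1` [set h i] by rewrite /B valK.
have mB h j : measurable (B h j) by rewrite /B; case: insubP.
pose A h := \bigcap_(j in [set j | (j < n)%N]) (X j @^-1` B h j).
have mA h : measurable (A h).
  apply: bigcap_measurableType => j /= jn.
  by rewrite -[X in measurable X]setTI; exact: mX.
have AE h w : \1_(A h) w = \prod_(i < n) (k (X i w) == h i)%:R :> R.
  rewrite indicE; case: (boolP [forall i : 'I_n, k (X i w) == h i]) => [/forallP e|].
    rewrite mem_set ?big1 // => [i _|j /= jn]; first by rewrite e.
    have /= -> := BE h (Ordinal jn); exact/eqP/(e (Ordinal jn)).
  rewrite negb_forall => /existsP[i ne]; rewrite memNset.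
    by rewrite (bigD1 i)//= (negbTE ne) mul0r.
  by move=> /(_ _ (ltn_ord i)); rewrite /= BE/= => /eqP; exact/negP.
transitivity (\int[P]_w (\sum_(h : {ffun 'I_n -> K}) ((\prod_i c (h i)) * \1_(A h) w)%:E))%E.
  apply: eq_integral => w _; rewrite sumEFin; congr EFin.
  under [RHS]eq_bigr do rewrite AE -big_split/=.
  rewrite -(bigA_distr_bigA (fun (i : 'I_n) a => c a * (k (X i w) == a)%:R)).
  apply: eq_bigr => i _; rewrite (bigD1 (k (X i w)))//= eqxx mulr1 big1 ?addr0//.
  by move=> a; rewrite eq_sym => /negbTE ->; rewrite mulr0.
rewrite ge0_integral_sum//; last 2 first.
- by move=> h; apply/measurable_EFinP; apply: measurable_funM => //; exact: measurable_indic.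
- by move=> h x _; rewrite lee_fin mulr_ge0// prodr_ge0.
rewrite -[in RHS](card_ord n) -prodr_const bigA_distr_bigA/= -sumEFin.
apply: eq_bigr => h _.
under eq_integral do rewrite EFinM.
rewrite ge0_integralZl//; last 2 first.
- by apply/measurable_EFinP; exact: measurable_indic.
- by rewrite lee_fin prodr_ge0.
rewrite integral_indic// setIT [X in (_ * X)%E](indepX (B h))// big_split/= EFinM; congr (_ * _)%E.
rewrite -prodEFin; apply: eq_bigr => i _.
by rewrite BE lawX// fineK// fin_num_measure.
Qed.

Variables (f f' : T -> R).
Hypotheses (mf : measurable_fun setT f) (mf' : measurable_fun setT f').

Definition jump (t : R) (x : T) : R := below (f x) t - below (f' x) t.
Definition jump_mean (t : R) : R :=
  fine (mu (f @^-1` `]-oo, t]%classic)) - fine (mu (f' @^-1` `]-oo, t]%classic)).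
(** A jump is -1, 0 or 1, so its first absolute moment is also its second moment. *)
Definition jump_var (t : R) : R := fine (\int[mu]_x (`|jump t x|)%:E)%E.

Lemma measurable_jump t : measurable_fun setT (jump t).
Proof.
by apply: measurable_funB; exact: (@measurable_below2 _ _ _ _ (cst t)).
Qed.

(** The jump sees a point only through these two bits, which reduces expectations to finite-valued
    functions. *)
Let atom (t : R) (x : T) : bool * bool := (f x <= t, f' x <= t).
Let atomj (a : bool * bool) : R := a.1%:R - a.2%:R.

Let measurable_le_set (h : T -> R) t : measurable_fun setT h -> measurable (h @^-1` `]-oo, t]%classic).
Proof.
move=> mh; rewrite -[X in measurable X]setTI; apply: mh => //; exact: measurable_itv.
Qed.

Let measurable_atom t a : measurable (atom t @^-1` [set a]).
Proof.
pose A (h : T -> R) (b : bool) := if b then h @^-1` `]-oo, t]%classic else ~` (h @^-1` `]-oo, t]%classic).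
have mA h b : measurable_fun setT h -> measurable (A h b).
  by move=> mh; rewrite /A; case: b; [|apply: measurableC]; exact: measurable_le_set.
have -> : atom t @^-1` [set a] = A f a.1 `&` A f' a.2.
  case: a => a b; apply/seteqP; split => x; rewrite /A /atom/=.
    by case=> <- <-; split; case: ifPn => /=; rewrite in_itv/= => // /negP.
  case: a => /=; case: b => /=; rewrite !in_itv/= => -[h1 h2]; congr pair => //; 
    by [rewrite h1|rewrite h2|apply/negbTE/negP].
by apply: measurableI; exact: mA.
Qed.

Let sum_atom t : 
  \sum_a atomj a * fine (mu (atom t @^-1` [set a])) = jump_mean t.
Proof.
have e1 : (mu (f @^-1` `]-oo, t]%classic) = (\sum_(a : bool * bool) a.1%:R * fine (mu (atom t @^-1` [set a])))%:E)%E.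
  rewrite -(integral_finite_valued _ (atom t) (fun a => a.1%:R))//.
  transitivity (\int[mu]_x (\1_(f @^-1` `]-oo, t]%classic) x)%:E)%E.
    by rewrite integral_indic ?setIT//; exact: measurable_le_set.
  apply: eq_integral => x _; rewrite indicE /atom/=; congr (_%:R%:E).
  by congr nat_of_bool; apply/idP/idP; rewrite inE/= in_itv.
have e2 : (mu (f' @^-1` `]-oo, t]%classic) = (\sum_(a : bool * bool) a.2%:R * fine (mu (atom t @^-1` [set a])))%:E)%E.
  rewrite -(integral_finite_valued _ (atom t) (fun a => a.2%:R))//.
  transitivity (\int[mu]_x (\1_(f' @^-1` `]-oo, t]%classic) x)%:E)%E.
    by rewrite integral_indic ?setIT//; exact: measurable_le_set.
  apply: eq_integral => x _; rewrite indicE /atom/=; congr (_%:R%:E).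
  by congr nat_of_bool; apply/idP/idP; rewrite inE/= in_itv.
rewrite /jump_mean e1 e2/= -sumrB; apply: eq_bigr => a _; by rewrite /atomj mulrBl.
Qed.

Let sum_atom_sq t : 
  \sum_a atomj a ^+ 2 * fine (mu (atom t @^-1` [set a])) = jump_var t.
Proof.
rewrite /jump_var.
transitivity (fine (\int[mu]_x (atomj (atom t x) ^+ 2)%:E)%E).
  rewrite (integral_finite_valued _ (atom t) (fun a => atomj a ^+ 2))// => a; exact: sqr_ge0.
congr fine; apply: eq_integral => x _; congr EFin; rewrite /atomj /jump /below /=.
by case: (f x <= t); case: (f' x <= t); rewrite ?subrr ?subr0 ?sub0r ?expr0n ?normr0 ?normrN ?normr1 ?sqrrN ?expr1n.
Qed.

Definition dev (w : Omega) (t : R) : R := \sum_(i < n) jump t (X i w) - n%:R * jump_mean t.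
(** Empirical quadratic variation plus its mean: the first part is the square subtracted in
    [expR_sub_sq], the second pays for the square that this inequality leaves on its right-hand
    side. *)
Definition devvar (w : Omega) (t : R) : R := \sum_(i < n) `|jump t (X i w)| + n%:R * jump_var t.

(** The reciprocal of the left side is at least [1 - x + x ^+ 2], and [(1 + x + x ^+ 2) * (1 - x + x
    ^+ 2) = 1 + x ^+ 2 + x ^+ 4]. *)
Lemma expR_sub_sq (x : R) : expR (x - x ^+ 2) <= 1 + x + x ^+ 2.
Proof.
have h : 1 - x + x ^+ 2 <= expR (x ^+ 2 - x) by apply: le_trans (expR_ge1Dx _); lra.
have e : expR (x - x ^+ 2) * expR (x ^+ 2 - x) = 1 by rewrite -expRD -expR0; congr expR; ring.
have p : 0 < 1 - x + x ^+ 2 by nra.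
have q : 1 <= (1 + x + x ^+ 2) * (1 - x + x ^+ 2) by nra.
have r := expR_gt0 (x - x ^+ 2).
rewrite -(ler_pM2r p); apply: le_trans q.
apply: (@le_trans _ _ (expR (x - x ^+ 2) * expR (x ^+ 2 - x))); last by rewrite e.
by rewrite ler_pM2l.
Qed.

(** Independence turns the expectation into an [n]-th power. By [expR_sub_sq] one factor is at most
    [1 + u * jump_mean t + u ^+ 2 * jump_var t], hence at most the exponential that [K] divides
    out. *)
Lemma expectation_exp_dev u t :
  (\int[P]_w (expR (u * dev w t - u ^+ 2 * devvar w t))%:E <= 1)%E.
Proof.
pose c a := expR (u * atomj a - (u * atomj a) ^+ 2).
pose K := expR (- (n%:R * (u * jump_mean t + u ^+ 2 * jump_var t))).
have e w : (expR (u * dev w t - u ^+ 2 * devvar w t))%:E = 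
   (K%:E * (\prod_(i < n) c (atom t (X i w)))%:E)%E.
  rewrite -EFinM /c -expR_sum -expRD; congr (expR _)%:E.
  rewrite [in RHS]sumrB -[in RHS]mulr_sumr.
  under [X in _ = _ + (_ - X)]eq_bigr do rewrite exprMn.
  rewrite -[in RHS]mulr_sumr /dev /devvar.
  have -> : \sum_(i < n) `|jump t (X i w)| = \sum_(i < n) atomj (atom t (X i w)) ^+ 2.
    apply: eq_bigr => i _; rewrite /atomj /jump /below/=.
    by case: (f _ <= t); case: (f' _ <= t); rewrite ?subrr ?subr0 ?sub0r ?expr0n ?normr0 ?normrN ?normr1 ?sqrrN ?expr1n.
  have -> : \sum_(i < n) jump t (X i w) = \sum_(i < n) atomj (atom t (X i w)) by [].
  ring.
under eq_integral do rewrite e.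
rewrite ge0_integralZl//; last 3 first.
- apply/measurable_EFinP; apply: measurable_prod => i _.
  have mj : measurable_fun setT (fun w => jump t (X i w)).
    by apply: (measurableT_comp (measurable_jump t)); exact: mX.
  have -> : (fun w => c (atom t (X i w))) =
      expR \o (fun w => u * jump t (X i w) - (u * jump t (X i w)) ^+ 2) by [].
  apply: measurableT_comp => //.
  by apply: measurable_funB; [|apply: measurable_funX]; apply: measurable_funM.
- by move=> w _; rewrite lee_fin prodr_ge0// => i _; exact: expR_ge0.
- by rewrite lee_fin expR_ge0.
rewrite integral_prod_finite_valued//; last by move=> a; exact: expR_ge0.
rewrite -EFinM lee_fin.
set A := \sum_a _.
have A0 : 0 <= A by apply: sumr_ge0 => a _; rewrite mulr_ge0// ?expR_ge0// fine_ge0.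
have AE : A <= expR (u * jump_mean t + u ^+ 2 * jump_var t).
  apply: le_trans (expR_ge1Dx _).
  have h1 : \sum_a fine (mu (atom t @^-1` [set a])) = 1.
    have := integral_finite_valued _ (atom t) (cst 1) (measurable_atom t) (fun=> ler01).
    have -> : (\int[mu]_x (cst 1 (atom t x))%:E = 1)%E.
      by rewrite /= integral_cst// mul1e; exact: probability_setT.
    move=> [->]; by apply: eq_bigr => a _; rewrite mul1r.
  have -> : 1 + (u * jump_mean t + u ^+ 2 * jump_var t) = 
     \sum_a (1 + u * atomj a + (u * atomj a) ^+ 2) * fine (mu (atom t @^-1` [set a])).
    rewrite -sum_atom -sum_atom_sq !mulr_sumr.
    rewrite -{1}h1 -!big_split/=; apply: eq_bigr => a _; ring.
  apply: ler_sum => a _; apply: ler_wpM2r; first by rewrite fine_ge0.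
  exact: expR_sub_sq.
rewrite /K expRN expRM_natl mulrC ler_pdivrMr ?mul1r ?exprn_gt0 ?expR_gt0//.
by apply: lerXn2r; rewrite ?nnegrE ?expR_ge0.
Qed.

Lemma expectation_exp_abs_dev u t :
  (\int[P]_w (expR (u * `|dev w t| - u ^+ 2 * devvar w t))%:E <= 2%:E)%E.
Proof.
pose h v w := (expR (v * dev w t - v ^+ 2 * devvar w t))%:E.
have mdev : measurable_fun setT (dev ^~ t).
  apply: measurable_funB => //; apply: measurable_sum => i.
  by apply: (measurableT_comp (measurable_jump t)); exact: mX.
have mdevvar : measurable_fun setT (devvar ^~ t).
  apply: measurable_funD => //; apply: measurable_sum => i; apply: measurableT_comp => //.
  by apply: (measurableT_comp (measurable_jump t)); exact: mX.
have mh v : measurable_fun setT (h v).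
  apply/measurable_EFinP; apply: measurableT_comp => //.
  by apply: measurable_funB; apply: measurable_funM.
apply: (@le_trans _ _ (\int[P]_w (h u w + h (- u)%R w))%E).
  apply: ge0_le_integral => //=.
  - apply/measurable_EFinP; apply: measurableT_comp => //.
    by apply: measurable_funB; apply: measurable_funM => //; exact: measurableT_comp.
  - exact: emeasurable_funD.
  - move=> w _; rewrite /h -EFinD lee_fin sqrrN.
    have e1 := expR_ge0 (u * dev w t - u ^+ 2 * devvar w t).
    have e2 := expR_ge0 (- u * dev w t - u ^+ 2 * devvar w t).
    case: (ger0P (dev w t)) => _; first by rewrite lerDl.
    by rewrite mulrN -mulNr lerDr.
rewrite ge0_integralD//; last 2 first.
- by move=> w _; rewrite lee_fin expR_ge0.
- by move=> w _; rewrite lee_fin expR_ge0.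
rewrite (_ : 2%:E = 1%:E + 1%:E)%E; last by rewrite -EFinD.
by apply: leeD; exact: expectation_exp_dev.
Qed.

Notation Z := (measurableTypeR R).
Notation leb := (@lebesgue_measure R).

Lemma measurable_jump2 dS (S : measurableType dS) (x : S -> T) (t : S -> Z) :
  measurable_fun setT x -> measurable_fun setT t ->
  measurable_fun setT (fun z => jump (t z) (x z)).
Proof.
move=> mx mt; apply: measurable_funB.
  by apply: (@measurable_below2 _ _ _ (f \o x) t) => //; exact: measurableT_comp.
by apply: (@measurable_below2 _ _ _ (f' \o x) t) => //; exact: measurableT_comp.
Qed.

Lemma measurable_jump_mean : measurable_fun (setT : set Z) jump_mean.
Proof.
apply: measurable_funB; apply: nondecreasing_measurable => // x y xy.
  apply: fine_le; rewrite ?fin_num_measure//; try exact: measurable_le_set.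
  apply: le_measure; rewrite ?inE; try exact: measurable_le_set.
  by move=> z /=; rewrite !in_itv/= => /le_trans; apply.
apply: fine_le; rewrite ?fin_num_measure//; try exact: measurable_le_set.
apply: le_measure; rewrite ?inE; try exact: measurable_le_set.
by move=> z /=; rewrite !in_itv/= => /le_trans; apply.
Qed.

Let jumpE (z : T * Z) : \bar R := (`|jump z.2 z.1|)%:E.

Let measurable_jumpE : measurable_fun setT jumpE.
Proof.
by apply/measurable_EFinP; apply: measurableT_comp => //; exact: measurable_jump2.
Qed.

Let jumpE_ge0 z : (0 <= jumpE z)%E.
Proof. by rewrite lee_fin. Qed.

Lemma measurable_jump_var : measurable_fun (setT : set Z) jump_var.
Proof.
apply: measurableT_comp => //.
exact: (measurable_fun_fubini_tonelli_G (m1 := mu) jumpE measurable_jumpE jumpE_ge0).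
Qed.

Lemma jump_le1 t x : `|jump t x| <= 1.
Proof. by rewrite /jump below_dist; case: (_ \in _). Qed.

Lemma jump_varE t : (\int[mu]_x (`|jump t x|)%:E = (jump_var t)%:E)%E.
Proof.
rewrite /jump_var fineK// ge0_fin_numE; last by apply: integral_ge0 => x _; rewrite lee_fin.
apply: (@le_lt_trans _ _ (\int[mu]_x (cst 1%:E x))%E); last first.
  by rewrite integral_cst// mul1e (le_lt_trans (probability_le1 _ _)) ?ltry.
apply: ge0_le_integral => //=.
- apply/measurable_EFinP; apply: measurableT_comp => //; exact: measurable_jump.
- by move=> x _; rewrite lee_fin jump_le1.
Qed.

Lemma jump_var_ge0 t : 0 <= jump_var t.
Proof. by rewrite fine_ge0// integral_ge0// => x _; rewrite lee_fin. Qed.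

Lemma devvar_ge0 w t : 0 <= devvar w t.
Proof. by rewrite addr_ge0 ?sumr_ge0// mulr_ge0 ?jump_var_ge0. Qed.

(** Gives the deterministic control of the part of the chain beyond its last grid. *)
Lemma normr_dev_le w t : `|dev w t| <= devvar w t.
Proof.
apply: (le_trans (ler_normB _ _)); apply: lerD; first exact: ler_norm_sum.
rewrite normrM normr_nat ler_wpM2l// -sum_atom -sum_atom_sq.
apply: (le_trans (ler_norm_sum _ _ _)); apply: ler_sum => -[b b'] _.
rewrite normrM [X in _ * X]ger0_norm ?fine_ge0// ler_wpM2r ?fine_ge0//.
by rewrite /atomj; case: b; case: b'; rewrite /= ?subrr ?subr0 ?sub0r ?normrN ?normr1 ?normr0 ?sqrrN ?expr1n ?expr0n.
Qed.

Lemma measurable_dev2 dS (S : measurableType dS) (w : S -> Omega) (t : S -> Z) :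
  measurable_fun setT w -> measurable_fun setT t ->
  measurable_fun setT (fun z => dev (w z) (t z)).
Proof.
move=> mw mt; apply: measurable_funB.
  apply: measurable_sum => i; apply: measurable_jump2 => //.
  exact: (measurableT_comp (mX _ (ltn_ord i))).
apply: measurable_funM => //; exact: (measurableT_comp measurable_jump_mean).
Qed.

Lemma measurable_devvar2 dS (S : measurableType dS) (w : S -> Omega) (t : S -> Z) :
  measurable_fun setT w -> measurable_fun setT t ->
  measurable_fun setT (fun z => devvar (w z) (t z)).
Proof.
move=> mw mt; apply: measurable_funD.
  apply: measurable_sum => i; apply: measurableT_comp => //; apply: measurable_jump2 => //.
  exact: (measurableT_comp (mX _ (ltn_ord i))).
apply: measurable_funM => //; exact: (measurableT_comp measurable_jump_var).
Qed.

(** * Integration over all thresholds *)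

Section weighted.
Variables (p a I : R).
Hypotheses (p1 : 1 <= p) (a0 : 0 < a).
Hypothesis intI : (\int[leb]_t (wt (- 1 - a) t)%:E <= I%:E)%E.
Let q := 2 * p + a.

Let integrand (l : R) (w : Omega) (t : Z) : R :=
  expR (l * wt (p + a) t * `|dev w t| - (l * wt (p + a) t) ^+ 2 * devvar w t).

(** Averaging over [t] with an integrable weight stands in for a supremum over thresholds, so no
    union bound in [t] is paid. *)
Definition expdev (l : R) (w : Omega) : \bar R :=
  (\int[leb]_t (wt (- 1 - a) t * integrand l w t)%:E)%E.

Let kernel l (z : Omega * Z) : \bar R := (wt (- 1 - a) z.2 * integrand l z.1 z.2)%:E.

Let measurable_integrand l dS (S : measurableType dS) (w : S -> Omega) (t : S -> Z) :
  measurable_fun setT w -> measurable_fun setT t ->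
  measurable_fun setT (fun z => integrand l (w z) (t z)).
Proof.
move=> mw mt; apply: measurableT_comp => //.
have mo : measurable_fun setT (fun z => l * wt (p + a) (t z)).
  apply: measurable_funM => //; exact: (measurableT_comp (measurable_wt _)).
apply: measurable_funB; apply: measurable_funM => //.
- by apply: measurableT_comp => //; exact: measurable_dev2.
- exact: measurable_funX.
- exact: measurable_devvar2.
Qed.

Let measurable_kernel l : measurable_fun setT (kernel l).
Proof.
apply/measurable_EFinP; apply: measurable_funM; last exact: measurable_integrand.
exact: (measurableT_comp (measurable_wt _)).
Qed.

Let kernel_ge0 l z : (0 <= kernel l z)%E.
Proof. by rewrite lee_fin mulr_ge0 ?wt_ge0// expR_ge0. Qed.

Lemma measurable_expdev l : measurable_fun setT (expdev l).
Proof.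
exact: (measurable_fun_fubini_tonelli_F (m2 := leb) (kernel l)
  (measurable_kernel l) (kernel_ge0 l)).
Qed.

Lemma expectation_expdev l : (\int[P]_w expdev l w <= 2%:E * I%:E)%E.
Proof.
rewrite /expdev (fubini_tonelli (m1 := P) (m2 := leb) (kernel l))//.
apply: (@le_trans _ _ (\int[leb]_t (2%:E * (wt (- 1 - a) t)%:E))%E); last first.
  rewrite ge0_integralZl//.
  - by rewrite lee_wpmul2l// lee_fin.
  - apply/measurable_EFinP; exact: measurable_wt.
  - by move=> t _; rewrite lee_fin wt_ge0.
apply: ge0_le_integral => //=.
- by move=> t _; apply: integral_ge0.
- exact: (measurable_fun_fubini_tonelli_G (m1 := P) (kernel l)).
- apply: measurable_funeM; apply/measurable_EFinP; exact: measurable_wt.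
move=> t _; rewrite /kernel/=.
under eq_integral do rewrite EFinM.
rewrite ge0_integralZl//.
- by rewrite muleC lee_wpmul2r ?lee_fin ?wt_ge0//; exact: expectation_exp_abs_dev.
- by apply/measurable_EFinP; exact: (measurable_integrand l _ _ id (cst t)).
- by move=> w _; rewrite lee_fin expR_ge0.
- by rewrite lee_fin wt_ge0.
Qed.

(** Markov's inequality for the mean computed in [expectation_expdev]. *)
Lemma expdev_tail l z : 0 < z ->
  measurable [set w | (z%:E < expdev l w)%E] /\
  (P [set w | z%:E < expdev l w] <= (2 * I / z)%:E)%E.
Proof.
move=> z0; set A := [set w | _].
have mA : measurable A.
  have -> : A = setT `&` expdev l @^-1` `]z%:E, +oo[%classic.
    by apply/seteqP; split => w /=; rewrite in_itv/= andbT// => -[].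
  by apply: measurable_expdev => //; exact: emeasurable_itv.
split=> //.
have fA : P A \is a fin_num by rewrite fin_num_measure.
rewrite -(fineK fA) lee_fin ler_pdivlMr// -lee_fin [leLHS]EFinM fineK// muleC EFinM.
apply: le_trans (expectation_expdev l).
have -> : P A = (\int[P]_w (\1_A w)%:E)%E by rewrite integral_indic// setIT.
rewrite -ge0_integralZl//; last 2 first.
- by apply/measurable_EFinP; exact: measurable_indic.
- by rewrite lee_fin ltW.
apply: ge0_le_integral => //=.
- by move=> w _; rewrite mule_ge0// lee_fin ltW.
- by apply: measurable_funeM; apply/measurable_EFinP; exact: measurable_indic.
- exact: measurable_expdev.
move=> w _; rewrite indicE; case: (boolP (w \in A)) => [|_]; rewrite ?mule1 ?mule0.
  by rewrite inE /A/= => /ltW.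
by apply: integral_ge0 => t _; exact: (kernel_ge0 l (w, t)).
Qed.

(* The exponent [y] of the integrand of [expdev] is linearised by
   [y <= ln z + expR y / z]. *)
Lemma weighted_dev_le l z B w : 0 < l -> 1 <= z -> (expdev l w <= z%:E)%E ->
  (\int[leb]_t (wt (q - 1) t * devvar w t)%:E <= B%:E)%E ->
  (\int[leb]_t (wt (p - 1) t * `|dev w t|)%:E <= (l * B + (I * ln z + 1) / l)%:E)%E.
Proof.
move=> l0 z1 hz hB.
have z0 : 0 < z by apply: lt_le_trans z1.
have lz0 : 0 <= ln z / l by rewrite divr_ge0 ?ln_ge0// ltW.
have lz1 : 0 <= (l * z)^-1 by rewrite invr_ge0 mulr_ge0// ltW.
pose h1 t : \bar R := (l%:E * (wt (q - 1) t * devvar w t)%:E)%E.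
pose h2 t : \bar R := ((ln z / l)%:E * (wt (- 1 - a) t)%:E)%E.
pose h3 t : \bar R := ((l * z)^-1%:E * (wt (- 1 - a) t * integrand l w t)%:E)%E.
have mV : measurable_fun (setT : set Z) (fun t => (wt (q - 1) t * devvar w t)%:E).
  apply/measurable_EFinP; apply: measurable_funM; first exact: measurable_wt.
  exact: (@measurable_devvar2 _ _ (cst w) id).
have mr : measurable_fun (setT : set Z) (fun t => (wt (- 1 - a) t)%:E).
  by apply/measurable_EFinP; exact: measurable_wt.
have mi : measurable_fun (setT : set Z) (fun t => (wt (- 1 - a) t * integrand l w t)%:E).
  apply/measurable_EFinP; apply: measurable_funM; first exact: measurable_wt.
  exact: (@measurable_integrand l _ _ (cst w) id).
have V0 t : (0 <= (wt (q - 1) t * devvar w t)%:E)%E.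
  by rewrite lee_fin mulr_ge0 ?wt_ge0// devvar_ge0.
have r0 t : (0 <= (wt (- 1 - a) t)%:E)%E by rewrite lee_fin wt_ge0.
have i0 t : (0 <= (wt (- 1 - a) t * integrand l w t)%:E)%E.
  exact: (kernel_ge0 l (w, t)).
have l0' : (0 <= l%:E)%E by rewrite lee_fin ltW.
apply: (@le_trans _ _ (\int[leb]_t (h1 t + (h2 t + h3 t)))%E).
  apply: ge0_le_integral => //=.
  - by move=> t _; rewrite lee_fin mulr_ge0 ?wt_ge0.
  - apply/measurable_EFinP; apply: measurable_funM; first exact: measurable_wt.
    by apply: measurableT_comp => //; exact: (@measurable_dev2 _ _ (cst w) id).
  - by do 2?[apply: emeasurable_funD]; apply: measurable_funeM.
  move=> t _; rewrite /h1 /h2 /h3 -!EFinM -!EFinD lee_fin.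
  have -> : wt (p - 1) t = wt (- 1 - a) t * wt (p + a) t.
    by rewrite -wtD; congr wt; ring.
  have -> : wt (q - 1) t = wt (- 1 - a) t * (wt (p + a) t * wt (p + a) t).
    by rewrite -!wtD; congr wt; rewrite /q; ring.
  rewrite /integrand.
  set r := wt (- 1 - a) t; set o := wt (p + a) t; set S := `|_|; set V := devvar w t.
  set y := _ - _.
  have r1 : 0 <= r by exact: wt_ge0.
  have hy : y <= ln z + expR y / z.
    have := expR_ge1Dx (y - ln z); rewrite expRB lnK ?posrE//; lra.
  have e : r * o * S = l * (r * (o * o) * V) + r * y / l.
    by rewrite /y; field; rewrite gt_eqF.
  rewrite e lerD2l; have := ler_wpM2l r1 hy.
  rewrite -(ler_pM2r (_ : 0 < l^-1)) ?invr_gt0// => /le_trans; apply.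
  by rewrite le_eqVlt; apply/orP; left; apply/eqP; field; rewrite !gt_eqF.
rewrite !ge0_integralD//; try by [move=> t _; rewrite ?adde_ge0 ?mule_ge0// lee_fin|
  apply: measurable_funeM|apply: emeasurable_funD; apply: measurable_funeM].
rewrite !ge0_integralZl//.
rewrite EFinD; apply: leeD; first by rewrite EFinM lee_wpmul2l.
rewrite (_ : (I * ln z + 1) / l = ln z / l * I + (l * z)^-1 * z); last first.
  by field; rewrite !gt_eqF.
by rewrite EFinD !EFinM; apply: leeD; rewrite lee_wpmul2l// lee_fin.
Qed.

(** After exchanging integrals, a point [x] contributes the weighted length of the interval between
    [f x] and [f' x]: the length gives [del * N x], the weight a power [q - 1] of [1 + N x],
    together a q-th power. The envelope [N] will be the Euclidean norm. *)
Lemma weighted_devvar_le (N : T -> R) (del m : R) w : 0 <= del ->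
  measurable_fun setT N -> 
  (forall x, `|f x| <= N x) -> (forall x, `|f' x| <= N x) ->
  (forall x, `|f x - f' x| <= del * N x) ->
  (\int[mu]_x ((1 + N x) `^ q)%:E <= m%:E)%E ->
  (\int[leb]_t (wt (q - 1) t * devvar w t)%:E <= 
     (del * (\sum_(i < n) (1 + N (X i w)) `^ q + n%:R * m))%:E)%E.
Proof.
move=> del0 mN fN f'N ff' hm.
have q1 : 0 <= q - 1 by move: p1 a0; rewrite /q; lra.
have N0 x : 0 <= N x by apply: le_trans (fN x).
have J x : (\int[leb]_t (wt (q - 1) t * `|jump t x|)%:E <= (del * (1 + N x) `^ q)%:E)%E.
  apply: (le_trans (integral_wt_le _ _ _ _ q1 (fN x) (f'N x))).
  rewrite lee_fin; apply: (@le_trans _ _ (del * (1 + N x) * (1 + N x) `^ (q - 1))).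
    rewrite ler_wpM2r ?powR_ge0//; apply: (le_trans (ff' x)).
    by rewrite ler_wpM2l// lerDr.
  by rewrite -mulrA powR_mulr ?ltr_pwDl.
pose h z : \bar R := (wt (q - 1) z.2 * `|jump z.2 z.1|)%:E.
have mh : measurable_fun (setT : set (T * Z)) h.
  apply/measurable_EFinP; apply: measurable_funM.
    exact: (measurableT_comp (measurable_wt _)).
  by apply: measurableT_comp => //; exact: measurable_jump2.
have h0 z : (0 <= h z)%E by rewrite lee_fin mulr_ge0 ?wt_ge0.
have mj x : measurable_fun (setT : set Z) (fun t => (wt (q - 1) t * `|jump t x|)%:E).
  apply/measurable_EFinP; apply: measurable_funM; first exact: measurable_wt.
  by apply: measurableT_comp => //; exact: (@measurable_jump2 _ _ (cst x) id).
have mv : measurable_fun (setT : set Z) (fun t => (wt (q - 1) t * jump_var t)%:E).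
  apply/measurable_EFinP; apply: measurable_funM; first exact: measurable_wt.
  exact: measurable_jump_var.
under eq_integral do rewrite /devvar mulrDr mulr_sumr (mulrCA _ n%:R) EFinD -sumEFin EFinM.
rewrite ge0_integralD//; last 4 first.
- by move=> t _; apply: sume_ge0 => i _; exact: (h0 (X i w, t)).
- by apply: emeasurable_sum => i; exact: mj.
- by move=> t _; rewrite mule_ge0// lee_fin mulr_ge0 ?wt_ge0// jump_var_ge0.
- exact: measurable_funeM.
rewrite mulrDr EFinD; apply: leeD.
  rewrite ge0_integral_sum//; last by move=> i t _; exact: (h0 (X i w, t)).
  by rewrite mulr_sumr -sumEFin; apply: lee_sum => i _; exact: J.
rewrite ge0_integralZl//; last by move=> t _; rewrite lee_fin mulr_ge0 ?wt_ge0// jump_var_ge0.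
rewrite mulrCA EFinM lee_wpmul2l//.
have -> : (\int[leb]_t (wt (q - 1) t * jump_var t)%:E = \int[leb]_t \int[mu]_x h (x, t))%E.
  apply: eq_integral => t _; rewrite EFinM -jump_varE -ge0_integralZl//.
  - by apply/measurable_EFinP; apply: measurableT_comp => //; exact: measurable_jump.
  - by rewrite lee_fin wt_ge0.
rewrite -(fubini_tonelli (m1 := mu) (m2 := leb) h)//.
apply: (@le_trans _ _ (\int[mu]_x (del%:E * ((1 + N x) `^ q)%:E))%E).
  apply: ge0_le_integral => //=.
  - by move=> x _; apply: integral_ge0.
  - exact: (measurable_fun_fubini_tonelli_F (m2 := leb) h).
  - apply: measurable_funeM; apply/measurable_EFinP; apply: (measurableT_comp (measurable_powR _)).
    exact: measurable_funD.
  by move=> x _; rewrite -EFinM; exact: J.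
rewrite ge0_integralZl//.
- by rewrite EFinM lee_wpmul2l.
- apply/measurable_EFinP; apply: (measurableT_comp (measurable_powR _)).
  exact: measurable_funD.
- by move=> x _; rewrite lee_fin powR_ge0.
Qed.

End weighted.

End iid_sample.

(** * Grid chains approximating a direction, and their entropy *)

Section euclidean_chains.
Context {R : realType}.

Lemma dotp_self_ge0 d (x : d.-tuple R) : 0 <= dotp x x.
Proof. by rewrite sumr_ge0// => i _; rewrite -expr2 sqr_ge0. Qed.

Lemma enorm_ge0 d (x : d.-tuple R) : 0 <= enorm x.
Proof. exact: sqrtr_ge0. Qed.

Lemma enorm_sq d (x : d.-tuple R) : enorm x ^+ 2 = dotp x x.
Proof. by rewrite sqr_sqrtr// dotp_self_ge0. Qed.

Lemma enorm_le d (x y : d.-tuple R) : 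
  (forall i, `|tnth x i| <= `|tnth y i|) -> enorm x <= enorm y.
Proof.
move=> xy; apply: ler_wsqrtr; apply: ler_sum => i _.
by rewrite -!expr2 -(real_normK (num_real _)) -[leRHS](real_normK (num_real _)) lerXn2r ?nnegrE.
Qed.

(** Cauchy-Schwarz, from the nonnegative square norm of [C * x - B * v]; the case [C = 0] forces [v]
    to vanish. *)
Lemma dotp_le d (x v : d.-tuple R) : `|dotp x v| <= enorm x * enorm v.
Proof.
set A := dotp x x; set C := dotp v v; set B := dotp x v.
have gen (c b : R) : \sum_(i < d) (c * tnth x i - b * tnth v i) ^+ 2 =
    c ^+ 2 * dotp x x - 2 * c * b * dotp x v + b ^+ 2 * dotp v v.
  by rewrite /dotp !mulr_sumr -sumrB -big_split/=; apply: eq_bigr => i _; ring.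
have key : B ^+ 2 <= A * C.
  have h : 0 <= \sum_(i < d) (C * tnth x i - B * tnth v i) ^+ 2.
    by apply: sumr_ge0 => i _; exact: sqr_ge0.
  have e : \sum_(i < d) (C * tnth x i - B * tnth v i) ^+ 2 = C * (C * A - B ^+ 2).
    by rewrite gen -/A -/B -/C; ring.
  have C0 : 0 <= C by exact: dotp_self_ge0.
  move: C0; rewrite le_eqVlt => /predU1P[C0|C0]; last first.
    by move: h; rewrite e pmulr_rge0// subr_ge0 mulrC.
  have v0 i : tnth v i = 0.
    apply/eqP; rewrite -sqrf_eq0 expr2; apply/eqP.
    have /esym/eqP := C0; rewrite psumr_eq0 => [/allP/(_ i)|j _]; last by rewrite -expr2 sqr_ge0.
    by rewrite mem_index_enum => /(_ isT)/eqP.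
  by rewrite /B /dotp big1 ?expr0n/= -?C0 ?mulr0// => i _; rewrite v0 mulr0.
rewrite -(ler_pXn2r (_ : (0 < 2)%N)) ?nnegrE ?mulr_ge0 ?enorm_ge0//.
by rewrite real_normK ?num_real// exprMn !enorm_sq.
Qed.

Lemma enorm_le_sup d (v : d.-tuple R) (y : R) : (0 < d)%N -> 0 <= y ->
  (forall i, `|tnth v i| <= y / Num.sqrt d%:R) -> enorm v <= y.
Proof.
move=> d0 y0 h; rewrite -(ler_pXn2r (_ : (0 < 2)%N)) ?nnegrE ?enorm_ge0// enorm_sq.
have r0 : 0 < Num.sqrt d%:R :> R by rewrite sqrtr_gt0 ltr0n.
have -> : y ^+ 2 = \sum_(i < d) (y / Num.sqrt d%:R) ^+ 2.
  rewrite sumr_const card_ord expr_div_n sqr_sqrtr ?ler0n// -[_ *+ d]mulr_natr divfK//.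
  by rewrite pnatr_eq0 -lt0n.
apply: ler_sum => i _; rewrite -expr2 -(real_normK (num_real (tnth v i))).
by rewrite lerXn2r ?nnegrE// divr_ge0// ltW.
Qed.

Lemma dotp_dist d (x v v' : d.-tuple R) (y : R) : (0 < d)%N -> 0 <= y ->
  (forall i, `|tnth v i - tnth v' i| <= y / Num.sqrt d%:R) -> 
  `|dotp x v - dotp x v'| <= y * enorm x.
Proof.
move=> d0 y0 h.
have -> : dotp x v - dotp x v' = dotp x [tuple tnth v i - tnth v' i | i < d].
  rewrite /dotp -sumrB; apply: eq_bigr => i _; by rewrite tnth_mktuple mulrBr.
apply: (le_trans (dotp_le _ _ _)); rewrite mulrC ler_wpM2r ?enorm_ge0//.
by apply: enorm_le_sup => // i; rewrite tnth_mktuple.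
Qed.

Lemma sum_normr_le d (v : d.-tuple R) : \sum_(i < d) `|tnth v i| <= Num.sqrt d%:R * enorm v.
Proof.
have := dotp_le _ [tuple `|tnth v i| | i < d] [tuple 1 | i < d].
have -> : enorm [tuple 1 | i < d] = Num.sqrt (d%:R : R).
  rewrite /enorm /dotp; congr Num.sqrt.
  under eq_bigr do rewrite tnth_mktuple mulr1.
  by rewrite sumr_const card_ord.
have -> : enorm [tuple `|tnth v i| | i < d] = enorm v.
  rewrite /enorm /dotp; congr Num.sqrt; apply: eq_bigr => i _.
  by rewrite tnth_mktuple -!expr2 real_normK// num_real.
rewrite mulrC; apply: le_trans; apply: le_trans (ler_norm _).
by rewrite /dotp; apply: ler_sum => i _; rewrite !tnth_mktuple mulr1.
Qed.

Section links.
Variables (d : nat).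
Notation r := (Num.sqrt (d%:R : R)).

(* A link joins a grid point to its predecessor on the grid that is four times
   coarser: the entries are the sign, the absolute coordinate of the head, and
   the absolute coordinate of the tail, each in units of its own mesh. *)
Definition link_index B := {ffun 'I_d -> bool * 'I_B * 'I_B}.

Definition link_head (k B : nat) (m : link_index B) : d.-tuple R :=
  [tuple (-1) ^+ (m i).1.1 * (m i).1.2%:R / (4 ^+ k * r) | i < d].

Definition link_tail (k B : nat) (m : link_index B) : d.-tuple R :=
  [tuple (-1) ^+ (m i).1.1 * (4 * (m i).2%:R) / (4 ^+ k * r) | i < d].

(* Charging [expR (4 ^- k * c)] for a coordinate [c] instead of a uniform price
   removes a [d * ln d] term from the entropy, since the coordinates of a grid
   point of the ball have l1-norm at most [4 ^ k * d]. *)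
Definition link_cost (k B : nat) (m : link_index B) : R :=
  \prod_(i < d) ((4 ^+ k.+1 * expR (4 ^- k * (m i).1.2%:R)) * 
                 (4 ^+ k.+1 * expR (4 ^- k * (m i).2%:R))).

Lemma link_cost_gt0 k B (m : link_index B) : 0 < link_cost k B m.
Proof.
by apply: prodr_gt0 => i _; rewrite !mulr_gt0 ?expR_gt0// exprn_gt0.
Qed.

Lemma link_cost_ge1 k B (m : link_index B) : 1 <= link_cost k B m.
Proof.
have h (c : nat) : 1 <= 4 ^+ k.+1 * expR (4 ^- k * c%:R) :> R.
  rewrite -[leLHS]mulr1 ler_pM ?exprn_ege1//; first by rewrite ler1n.
  by rewrite -[leLHS]expR0 ler_expR mulr_ge0// invr_ge0 exprn_ge0.
apply: (big_ind (fun x => 1 <= x)) => // [x y|i _]; first exact: mulr_ege1.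
by apply: mulr_ege1.
Qed.

(** With [u = 4 ^- k <= 1] the ratio [x = expR (- u)] satisfies [1 - x >= u / 2], so the geometric
    sum is at most [2 / u], against the prefactor [u / 4]. *)
Lemma sum_expR_geometric k B : 
  \sum_(c < B) (4 ^+ k.+1 * expR (4 ^- k * c%:R))^-1 <= 2^-1 :> R.
Proof.
set u : R := 4 ^- k.
have u0 : 0 < u by rewrite invr_gt0 exprn_gt0.
have u1 : u <= 1 by rewrite invf_le1 ?exprn_gt0// exprn_ege1// ler1n.
have p4 : 0 < 4 ^+ k :> R by rewrite exprn_gt0.
pose x := expR (- u).
have -> : \sum_(c < B) (4 ^+ k.+1 * expR (u * c%:R))^-1 = u / 4 * \sum_(c < B) x ^+ c.
  rewrite mulr_sumr; apply: eq_bigr => c _.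
  rewrite /x -expRM_natl mulrN expRN invfM exprS invfM /u (mulrC c%:R).
  by rewrite (mulrC 4^-1).
have x0 : 0 < x by exact: expR_gt0.
have x1 : x * (1 + u) <= 1.
  rewrite /x expRN mulrC ler_pdivrMr ?expR_gt0// mul1r; exact: expR_ge1Dx.
have hs : (1 - x) * \sum_(c < B) x ^+ c <= 1.
  have := subrX1 x B; rewrite -[in X in X = _]opprB -[in X in _ = X * _]opprB mulNr => /oppr_inj <-.
  by rewrite lerBlDr lerDl exprn_ge0// ltW.
have s0 : 0 <= \sum_(c < B) x ^+ c by apply: sumr_ge0 => c _; rewrite exprn_ge0// ltW.
nra.
Qed.

(** A Kraft inequality: reciprocal costs form a subprobability on links, ready for a weighted union
    bound. A coordinate contributes two signs times two sums of at most 1/2 each, hence at most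
    1/2. *)
Lemma sum_link_cost k B : \sum_(m : link_index B) (link_cost k B m)^-1 <= 1.
Proof.
pose w (c : 'I_B) : R := (4 ^+ k.+1 * expR (4 ^- k * c%:R))^-1.
have -> : \sum_(m : link_index B) (link_cost k B m)^-1 =
    \sum_(m : link_index B) \prod_(i < d) (w (m i).1.2 * w (m i).2).
  by apply: eq_bigr => m _; rewrite -prodfV; apply: eq_bigr => i _; rewrite invfM.
rewrite -(bigA_distr_bigA (fun (i : 'I_d) (a : bool * 'I_B * 'I_B) => w a.1.2 * w a.2)).
rewrite prodr_const; apply: exprn_ile1.
  by apply: sumr_ge0 => a _; rewrite mulr_ge0// invr_ge0 mulr_ge0 ?exprn_ge0 ?expR_ge0.
rewrite -(pair_bigA _ (fun a b => w a.2 * w b))/=.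
rewrite -(pair_bigA _ (fun (b : bool) a => \sum_c w a * w c))/=.
rewrite big_bool/=.
under eq_bigr do rewrite -mulr_sumr.
rewrite -mulr_suml.
have := sum_expR_geometric k B; rewrite -/w; set S := \sum_(_ < _) _.
have : 0 <= S by apply: sumr_ge0 => c _; rewrite invr_ge0 mulr_ge0 ?exprn_ge0 ?expR_ge0.
nra.
Qed.

(** The largest coordinate, in mesh units, of a grid point obtained from a unit vector. *)
Definition grid_size (k : nat) : nat := Num.truncn (4 ^+ k * r).

Section chain.
Hypothesis d0 : (0 < d)%N.
Variable theta : d.-tuple R.
Hypothesis theta1 : enorm theta = 1.

Let r0 : 0 < r. Proof. by rewrite sqrtr_gt0 ltr0n. Qed.

(** Rounding towards zero keeps the chain inside the unit ball and lets all its levels share the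
    signs of [theta]. *)
Let coord (k : nat) (i : 'I_d) : nat := Num.truncn (4 ^+ k * r * `|tnth theta i|).

Let sg (i : 'I_d) : R := (-1) ^+ (tnth theta i < 0)%R.

Let thetaE i : tnth theta i = sg i * `|tnth theta i|.
Proof.
rewrite /sg; case: (ltP (tnth theta i) 0) => h; rewrite /= ?expr1 ?expr0.
  by rewrite ltr0_norm// mulN1r opprK.
by rewrite ger0_norm// mul1r.
Qed.

Let sg1 i : `|sg i| = 1.
Proof. by rewrite /sg normrX normrN normr1 expr1n. Qed.

Let u0 k : 0 < 4 ^+ k * r :> R. Proof. by rewrite mulr_gt0// exprn_gt0. Qed.

Let coord_le k i : (coord k i)%:R <= 4 ^+ k * r * `|tnth theta i|.
Proof. by rewrite /coord truncn_le mulr_ge0// ltW. Qed.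

Let coord_gt k i : 4 ^+ k * r * `|tnth theta i| < (coord k i).+1%:R.
Proof. exact: truncnS_gt. Qed.

Let coord_div_le k i : (coord k i)%:R / (4 ^+ k * r) <= `|tnth theta i|.
Proof. by rewrite ler_pdivrMr// mulrC. Qed.

Let coord_div_ge k i : `|tnth theta i| - (4 ^- k / r) <= (coord k i)%:R / (4 ^+ k * r).
Proof.
rewrite ler_pdivlMr// mulrBl; have := coord_gt k i; rewrite -(natr1 (coord k i)).
have -> : 4 ^- k / r * (4 ^+ k * r) = 1 by field; rewrite !gt_eqF ?exprn_gt0.
by rewrite (mulrC _ (4 ^+ k * r)); lra.
Qed.

Let normr_theta_le1 i : `|tnth theta i| <= 1.
Proof.
have := dotp_le _ theta [tuple (i == j)%:R | j < d].
rewrite theta1 mul1r.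
have -> : dotp theta [tuple (i == j)%:R | j < d] = tnth theta i.
  rewrite /dotp (bigD1 i)//= tnth_mktuple eqxx mulr1 big1 ?addr0// => j.
  by rewrite tnth_mktuple eq_sym => /negbTE ->; rewrite mulr0.
move/le_trans; apply; rewrite /enorm /dotp (bigD1 i)//= tnth_mktuple eqxx mulr1.
rewrite big1 ?addr0 ?sqrtr1// => j.
by rewrite tnth_mktuple eq_sym => /negbTE ->; rewrite mulr0.
Qed.

Let coord_bound k i : (coord k i < (grid_size k).+1)%N.
Proof.
rewrite ltnS; apply: le_truncn; rewrite ler_piMr ?normr_theta_le1//; exact: ltW.
Qed.

(** The index is shifted: [chain k.+1] lies on the grid of level [k]. The chain starts at the
    origin, where every point projects to 0 and the empirical process vanishes. *)
Definition chain (k : nat) : d.-tuple R :=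
  if k is k'.+1 then [tuple sg i * ((coord k' i)%:R / (4 ^+ k' * r)) | i < d]
  else [tuple 0 | i < d].

Definition chain_link (k : nat) : link_index (grid_size k).+1 :=
  [ffun i => (tnth theta i < 0, inord (coord k i),
              inord (if k is k'.+1 then coord k' i else 0%N))].

Lemma chain_head k : link_head k _ (chain_link k) = chain k.+1.
Proof.
apply: eq_from_tnth => i; rewrite !tnth_mktuple ffunE/= inordK ?coord_bound//.
by rewrite mulrA.
Qed.

Let prev_coord_le k i :
  ((if k is k'.+1 then coord k' i else 0) <= coord k i)%N.
Proof.
case: k => // k; apply: le_truncn; rewrite exprS ler_wpM2r// ler_wpM2r ?(ltW r0)//.
by rewrite ler_peMl ?exprn_ge0// ler1n.
Qed.

Lemma chain_tail k : link_tail k _ (chain_link k) = chain k.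
Proof.
apply: eq_from_tnth => i; rewrite !tnth_mktuple ffunE/= inordK; last first.
  exact: leq_ltn_trans (prev_coord_le k i) (coord_bound k i).
case: k => [|k] /=; rewrite tnth_mktuple; first by rewrite mulr0 mulr0 mul0r.
rewrite -/(sg i) -!mulrA; congr (_ * _); rewrite exprS.
by field; rewrite !gt_eqF ?exprn_gt0.
Qed.

Lemma enorm_chain k : enorm (chain k) <= 1.
Proof.
rewrite -theta1; apply: enorm_le => i; case: k => [|k]; rewrite tnth_mktuple ?normr0//.
by rewrite normrM sg1 mul1r ger0_norm ?coord_div_le.
Qed.

Lemma dotp_chain_theta x k : 
  `|dotp x theta - dotp x (chain k.+1)| <= 4 ^- k * enorm x.
Proof.
apply: dotp_dist => // i.
rewrite tnth_mktuple {1}thetaE -mulrBr normrM sg1 mul1r.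
have := coord_div_le k i; have := coord_div_ge k i => h1 h2.
by rewrite ger0_norm ?subr_ge0//; lra.
Qed.

(** Both roundings approach [theta] from the same side, so they differ by at most the coarser mesh,
    which is 4 times the finer one. At level 0 the bound is just that of the unit ball. *)
Lemma dotp_chain x k :
  `|dotp x (chain k.+1) - dotp x (chain k)| <= 4 * 4 ^- k * enorm x.
Proof.
case: k => [|k].
  have -> : dotp x (chain 0) = 0.
    by rewrite /dotp big1// => i _; rewrite tnth_mktuple mulr0.
  rewrite subr0 expr0 invr1 mulr1; apply: (le_trans (dotp_le _ _ _)).
  rewrite mulrC ler_wpM2r ?enorm_ge0//; apply: (le_trans (enorm_chain 1)).
  by rewrite ler1n.
apply: dotp_dist => // i.
rewrite !tnth_mktuple -mulrBr normrM sg1 mul1r.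
have := coord_div_le k i; have := coord_div_ge k i => h1 h2.
have := coord_div_le k.+1 i; have := coord_div_ge k.+1 i => h3 h4.
have e : 4 * 4 ^- k.+1 / r = 4 ^- k / r.
  by rewrite exprS; field; rewrite !gt_eqF ?exprn_gt0.
have e3 : 4 ^- k.+1 / r <= 4 ^- k / r.
  rewrite -e -mulrA ler_peMl ?ler1n// mulr_ge0// ?invr_ge0 ?exprn_ge0//; exact: ltW.
rewrite e ler_norml; apply/andP; split; lra.
Qed.

(** The two powers of 4 per coordinate cost [4 * d * k.+1] in the exponent; the l1-norm of [theta],
    at most the square root of [d], limits the coordinate charges to [2 * d]. *)
Lemma link_cost_chain k : link_cost k _ (chain_link k) <= expR (6 * d%:R * k.+1%:R).
Proof.
have four : 4 ^+ k.+1 <= expR (2 * k.+1%:R) :> R.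
  rewrite mulrC expRM_natl lerXn2r ?nnegrE ?expR_ge0//.
  have e1 : 2 <= expR 1 :> R by apply: le_trans (expR_ge1Dx 1); lra.
  have -> : expR 2 = expR 1 * expR 1 :> R by rewrite -expRD; congr expR; lra.
  nra.
pose b i : R := 2 * (2 * k.+1%:R + r * `|tnth theta i|).
have step c i : (c <= coord k i)%N -> 
    4 ^+ k.+1 * expR (4 ^- k * c%:R) <= expR (2 * k.+1%:R + r * `|tnth theta i|).
  move=> hc; rewrite expRD; apply: ler_pM; rewrite ?exprn_ge0 ?expR_ge0//.
  rewrite ler_expR mulrC ler_pdivrMr ?exprn_gt0//.
  have : (c%:R : R) <= (coord k i)%:R by rewrite ler_nat.
  move=> /le_trans; apply; apply: (le_trans (coord_le k i)).
  by rewrite le_eqVlt; apply/orP; left; apply/eqP; ring.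
apply: (@le_trans _ _ (\prod_(i < d) expR (b i))).
  apply: ler_prod => i _; rewrite !mulr_ge0 ?exprn_ge0 ?expR_ge0//=.
  rewrite /b mulr_natl mulr2n expRD ffunE/=.
  rewrite !inordK ?coord_bound//; last exact: leq_ltn_trans (prev_coord_le k i) (coord_bound k i).
  by apply: ler_pM; rewrite ?mulr_ge0 ?exprn_ge0 ?expR_ge0// step.
rewrite -expR_sum ler_expR /b -mulr_sumr big_split/= sumr_const card_ord -mulr_sumr.
have := sum_normr_le _ theta; rewrite theta1 mulr1 => hs.
have rr : r * r = d%:R by rewrite -expr2 sqr_sqrtr// ler0n.
have : r * \sum_(i < d) `|tnth theta i| <= d%:R by rewrite -[leRHS]rr ler_wpM2l// ltW.
rewrite -(mulr_natl (2 * k.+1%:R) d); move: (r * _) => y hy.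
have k1 : 1 <= k.+1%:R :> R by rewrite ler1n.
have : 0 <= d%:R * (k.+1%:R - 1) :> R by rewrite mulr_ge0 ?ler0n// subr_ge0.
lra.
Qed.

End chain.

End links.

End euclidean_chains.

(** * Union bounds *)

Section union_bounds.
Context {R : realType} dO (Omega : measurableType dO) (P : probability Omega R).

Lemma sum_half_pow (n : nat) : \sum_(k < n) (2 ^- k.+1 : R) = 1 - 2 ^- n.
Proof.
elim: n => [|n IH]; first by rewrite big_ord0 expr0 invr1 subrr.
by rewrite big_ord_recr/= IH exprS; field; rewrite expf_neq0.
Qed.

Lemma measure_bigcup_geometric (E : nat -> set Omega) (b : R) : 0 <= b ->
  (forall k, measurable (E k)) -> (forall k, P (E k) <= (b / 2 ^+ k.+1)%:E)%E ->
  (P (\bigcup_k E k) <= b%:E)%E.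
Proof.
move=> b0 mE hE.
apply: (@le_trans _ _ (\sum_(0 <= k <oo) P (E k))%E).
  by apply: measure_sigma_subadditive => //; exact: bigcup_measurable.
apply: lime_le; first exact: is_cvg_nneseries.
apply: nearW => n /=.
apply: (@le_trans _ _ (\sum_(0 <= k < n) (b / 2 ^+ k.+1)%:E)%E); first exact: lee_sum.
rewrite sumEFin lee_fin big_mkord -mulr_sumr sum_half_pow.
by rewrite ler_piMr// lerBlDr lerDl invr_ge0 exprn_ge0.
Qed.

Lemma measure_bigsetU_le (I : Type) (r : seq I) (E : I -> set Omega) :
  (forall i, measurable (E i)) ->
  (P (\big[setU/set0]_(i <- r) E i) <= \sum_(i <- r) P (E i))%E.
Proof.
move=> mE; elim: r => [|i r IH]; first by rewrite !big_nil measure0.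
rewrite !big_cons.
apply: (@le_trans _ _ (P (E i) + P (\big[setU/set0]_(j <- r) E j)))%E; last exact: leeD.
by apply: measureU2 => //; exact: bigsetU_measurable.
Qed.

End union_bounds.

(** * Scalar inequalities balancing bracket, entropy and moments *)

Section elementary_bounds.
Context {R : realType}.

Lemma sum_succ_half_pow K : \sum_(k < K) (k.+1%:R * 2 ^- k : R) <= 4.
Proof.
suff -> : \sum_(k < K) (k.+1%:R * 2 ^- k : R) = 4 - 2 * (K.+2%:R * 2 ^- K).
  by rewrite lerBlDr lerDl !mulr_ge0 ?ler0n// invr_ge0 exprn_ge0.
elim: K => [|K IH]; first by rewrite big_ord0 expr0 invr1; lra.
rewrite big_ord_recr/= IH exprS.
have -> : K.+3%:R = K%:R + 3 :> R by rewrite -addn3 natrD.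
have -> : K.+2%:R = K%:R + 2 :> R by rewrite -addn2 natrD.
have -> : K.+1%:R = K%:R + 1 :> R by rewrite natr1.
by field; rewrite expf_neq0.
Qed.

Lemma powR_le1D (u tau : R) : 0 <= u -> 0 <= tau <= 1 -> u `^ tau <= 1 + u.
Proof.
move=> u0 /andP[t0 t1]; have [u1|u1] := leP u 1.
  apply: (@le_trans _ _ 1); last by rewrite lerDl.
  have <- : 1 `^ tau = 1 :> R by rewrite powR1.
  by rewrite ge0_ler_powR// nnegrE.
apply: (@le_trans _ _ u); last by rewrite lerDr.
by rewrite -[leRHS](powRr1 u0) ler_powR// ltW.
Qed.

(* Young's inequality at scale [j]: it replaces Jensen's inequality when
   comparing the q-th and s-th moments. *)
Lemma powR_scale_le (y q s : R) (j : nat) : 1 <= y -> 0 <= q -> 0 < s -> q <= s ->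
  y `^ q <= expR (q / s * j%:R) * (1 + y `^ s * expR (- j%:R)).
Proof.
move=> y1 q0 s0 qs.
have y0 : 0 <= y by apply: le_trans y1.
have -> : y `^ q = expR (q / s * j%:R) * (y `^ s * expR (- j%:R)) `^ (q / s).
  rewrite powRM ?powR_ge0 ?expR_ge0// -powRrM mulrC -mulrA.
  rewrite -[expR (- _) `^ _]/(expR (- j%:R) `^ (q / s)) -expRM mulNr -mulrN.
  have -> : s * (q / s) = q by field; rewrite gt_eqF.
  rewrite -[LHS]mulr1 -mulrA; congr (_ * _).
  by rewrite -expRD -[LHS]expR0; congr expR; ring.
rewrite ler_pM2l ?expR_gt0//; apply: powR_le1D.
  by rewrite mulr_ge0 ?powR_ge0 ?expR_ge0.
by rewrite divr_ge0 ?(ltW s0)//= ler_pdivrMr// mul1r.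
Qed.

(** The spare exponential [expR ((1 - tau) * j / 2)] dominates the factor [j.+1] coming from the
    peeling. *)
Lemma natr_expR_le (j : nat) (tau : R) : 0 < tau < 1 ->
  j.+1%:R * expR (tau * j%:R / 2) <= 2 / (1 - tau) * expR (j%:R / 2).
Proof.
move=> /andP[t0 t1]; set b := (1 - tau) / 2.
have b0 : 0 < b by rewrite /b divr_gt0// subr_gt0.
have h : b * j.+1%:R <= expR (b * j%:R).
  apply: (le_trans _ (expR_ge1Dx _)); rewrite -natr1 mulrDr mulr1 addrC lerD2r /b.
  lra.
have -> : expR (j%:R / 2) = expR (b * j%:R) * expR (tau * j%:R / 2) :> R.
  by rewrite -expRD; congr expR; rewrite /b; field.
rewrite mulrA ler_wpM2r ?expR_ge0//.
have -> : 2 / (1 - tau) = b^-1 by rewrite /b invf_div.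
by rewrite mulrC ler_pdivlMr// mulrC.
Qed.

Lemma ler2_expR1 : 2 <= expR 1 :> R.
Proof. by apply: le_trans (expR_ge1Dx 1); lra. Qed.

Lemma exp2_le_expR (k : nat) : 2 ^+ k <= expR k%:R :> R.
Proof. 
by rewrite -[k%:R]mulr1 expRM_natl lerXn2r ?nnegrE ?expR_ge0// ler2_expR1.
Qed.

Section level.
Variables (I eps nn dd tau : R) (k j : nat).
Hypotheses (I1 : 1 <= I) (eps0 : 0 < eps) (nn0 : 0 < nn) (dd0 : 0 <= dd).
Hypothesis big : 128 * (dd + 1) <= nn * eps ^+ 2.

(* Level [k] of the chain and peeling slice [j]: the rate balances the bracket,
   of order [4^-k * n * expR (tau * j)], against the entropy, of order
   [n * eps^2]. *)
Definition rate : R := eps * 2 ^+ k * expR (- (tau * j%:R / 2)).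

(** Chosen so that [expdev_tail] leaves the target probability [expR (- n * eps ^+ 2 / 2)], split
    over levels and slices by the powers of 2 and over links by their cost [W]. *)
Definition threshold (W : R) : R :=
  2 * I * expR (nn * eps ^+ 2 / 2) * 2 ^+ k.+1 * 2 ^+ j.+1 * W.

Lemma rate_gt0 : 0 < rate.
Proof. by rewrite !mulr_gt0 ?exprn_gt0 ?expR_gt0. Qed.

Lemma threshold_ge1 W : 1 <= W -> 1 <= threshold W.
Proof.
move=> W1; rewrite /threshold; do !apply: mulr_ege1 => //.
- by rewrite ler1n.
- rewrite -[leLHS]expR0 ler_expR divr_ge0// mulr_ge0 ?sqr_ge0//; exact: ltW.
- by rewrite exprn_ege1// ler1n.
- by rewrite exprn_ege1// ler1n.
Qed.

(** Taking logarithms turns the factors into summands, each controlled through [1 <= nn * eps ^+ 2]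
    and [6 * dd <= nn * eps ^+ 2], both consequences of [big]; [2 * I] enters through
    [2 * I <= expR (2 * I)]. *)
Lemma ln_threshold_le W : 0 < W -> W <= expR (6 * dd * k.+1%:R) ->
  ln (threshold W) <= (2 * I + 4) * (nn * eps ^+ 2 * k.+1%:R * j.+1%:R).
Proof.
move=> W0 hW; set k0 := nn * eps ^+ 2; set x := k.+1%:R; set y := j.+1%:R.
have x1 : 1 <= x by rewrite ler1n.
have y1 : 1 <= y by rewrite ler1n.
have I0 : 0 < I by apply: lt_le_trans I1.
have k1 : 1 <= k0 by rewrite /k0; apply: le_trans big; have := dd0; lra.
apply: (@le_trans _ _ (2 * I + k0 / 2 + x + y + 6 * dd * x)); last first.
  have a1 : k0 * x <= k0 * x * y by rewrite ler_peMr// mulr_ge0//; lra.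
  have a2 : k0 <= k0 * x by rewrite ler_peMr//; lra.
  have a3 : x <= k0 * x by rewrite ler_peMl//; lra.
  have kx : 1 <= k0 * x by exact: mulr_ege1.
  have y0 : 0 <= y by exact: le_trans y1.
  have a4 : y <= k0 * x * y by rewrite ler_peMl.
  have a5 : 6 * dd * x <= k0 * x.
    by rewrite ler_pM2r; [apply: le_trans big; have := dd0; lra|lra].
  have a6 : 2 * I * 1 <= 2 * I * (k0 * x * y).
    by rewrite ler_pM2l; [lra|lra].
  lra.
rewrite -[leRHS]expRK ler_ln ?posrE ?expR_gt0//; last first.
  by rewrite /threshold !mulr_gt0 ?expR_gt0 ?exprn_gt0.
have I2 : 0 <= 2 * I by rewrite mulr_ge0// ltW.
rewrite /threshold !expRD; apply: ler_pM => //; [by rewrite !mulr_ge0 ?expR_ge0 ?exprn_ge0 ?(ltW I0)|exact: ltW|].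
apply: ler_pM; rewrite ?exp2_le_expR ?exprn_ge0//; first by rewrite !mulr_ge0 ?expR_ge0 ?exprn_ge0 ?(ltW I0).
apply: ler_pM; rewrite ?exp2_le_expR ?exprn_ge0//; first by rewrite !mulr_ge0 ?expR_ge0 ?(ltW I0).
apply: ler_pM; rewrite ?expR_ge0//.
by apply: le_trans (expR_ge1Dx _); lra.
Qed.

(** The bracket term has coefficient 12, the entropy term [I * (2 * I + 4)], and the remaining
    [1 / rate] accounts for the last unit in 13. *)
Lemma level_bound W : 0 < W -> W <= expR (6 * dd * k.+1%:R) ->
  rate * (4 * 4 ^- k * (3 * nn * expR (tau * j%:R))) + (I * ln (threshold W) + 1) / rate
  <= (13 + I * (2 * I + 4)) * (nn * eps) * (k.+1%:R * 2 ^- k) * 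
     (j.+1%:R * expR (tau * j%:R / 2)).
Proof.
move=> W0 hW; have hl := ln_threshold_le _ W0 hW.
have I0 : 0 < I by apply: lt_le_trans I1.
set e := expR (tau * j%:R / 2).
have e0 : 0 < e by exact: expR_gt0.
have -> : expR (tau * j%:R) = e * e by rewrite -expRD; congr expR; field.
have rE : rate = eps * 2 ^+ k / e by rewrite /rate expRN.
have p2 : 0 < 2 ^+ k :> R by rewrite exprn_gt0.
have -> : 4 ^+ k = 2 ^+ k * 2 ^+ k :> R by rewrite -exprMn; congr (_ ^+ _); lra.
set t := 2 ^+ k in p2 rE *; set x := k.+1%:R; set y := j.+1%:R.
have x1 : 1 <= x by rewrite ler1n.
have y1 : 1 <= y by rewrite ler1n.
rewrite rE.
have e1 : eps * t / e * (4 * (t * t)^-1 * (3 * nn * (e * e))) = 12 * (nn * eps) * t^-1 * e.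
  by field; rewrite !gt_eqF.
have k1 : 1 <= nn * eps ^+ 2 * x * y.
  do 2?[apply: mulr_ege1 => //]; apply: le_trans big; have := dd0; lra.
have e2 : (I * ln (threshold W) + 1) / (eps * t / e) <=
    (I * (2 * I + 4) + 1) * (nn * eps) * (x * t^-1) * (y * e).
  have -> : (I * (2 * I + 4) + 1) * (nn * eps) * (x * t^-1) * (y * e) =
    ((I * (2 * I + 4) + 1) * (nn * eps ^+ 2 * x * y)) / (eps * t / e).
    by field; rewrite !gt_eqF.
  rewrite ler_pM2r; last by rewrite invr_gt0 divr_gt0// mulr_gt0.
  rewrite mulrDl mul1r -mulrA; apply: lerD => //.
  by rewrite ler_pM2l.
have e3 : 12 * (nn * eps) * t^-1 * e <= 12 * (nn * eps) * (x * t^-1) * (y * e).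
  have h0 : 0 <= 12 * (nn * eps) * t^-1 * e by rewrite !mulr_ge0 ?invr_ge0 ?ltW.
  have -> : 12 * (nn * eps) * (x * t^-1) * (y * e) = 12 * (nn * eps) * t^-1 * e * (x * y) by ring.
  by rewrite ler_peMr// mulr_ege1.
by rewrite e1; apply: (le_trans (lerD e3 e2)); rewrite -!mulrDl; lra.
Qed.

End level.

End elementary_bounds.

(** * The deterministic chaining bound for a good sample in slice [j] *)

Section good_sample.
Context {R : realType} dO (Omega : measurableType dO) (d : nat).
Variables (mu : probability (d.-tuple R) R) (n : nat) (X : nat -> Omega -> d.-tuple R).
Hypotheses (d0 : (0 < d)%N) (n0 : (0 < n)%N).
Hypothesis mX : forall j, (j < n)%N -> measurable_fun setT (X j).
Notation leb := (@lebesgue_measure R).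
Notation Z := (measurableTypeR R).
Notation Dev v v' := (dev dO Omega _ _ mu n X (fun x => dotp x v) (fun x => dotp x v')).
Notation Devvar v v' := (devvar dO Omega _ _ mu n X (fun x => dotp x v) (fun x => dotp x v')).

Lemma measurable_dotp (v : d.-tuple R) : measurable_fun setT (fun x => dotp x v).
Proof.
apply: measurable_sum => i; apply: measurable_funM => //; exact: measurable_tnth.
Qed.

Lemma measurable_enorm : measurable_fun setT (@enorm R d).
Proof.
have -> : @enorm R d = (fun y => Num.sqrt y) \o (fun x => dotp x x) by [].
apply: measurableT_comp; first by apply: continuous_measurable_fun; exact: sqrt_continuous.
apply: measurable_sum => i; apply: measurable_funM; exact: measurable_tnth.
Qed.

Lemma measurable_powR_enorm r : measurable_fun setT (fun x : d.-tuple R => (1 + enorm x) `^ r).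
Proof.
apply: (measurableT_comp (measurable_powR _)).
by apply: measurable_funD => //; exact: measurable_enorm.
Qed.

Lemma dev_add v1 v2 v3 w t : Dev v1 v3 w t = Dev v1 v2 w t + Dev v2 v3 w t.
Proof.
rewrite /dev /jump /jump_mean !sumrB; ring.
Qed.

Lemma normr_dev_chain_le (c : nat -> d.-tuple R) v K w t :
  `|Dev v (c 0%N) w t| <= `|Dev v (c K) w t| + \sum_(k < K) `|Dev (c k.+1) (c k) w t|.
Proof.
elim: K => [|K IH]; first by rewrite big_ord0 addr0.
rewrite big_ord_recr/=.
have h : `|Dev v (c K) w t| <= `|Dev v (c K.+1) w t| + `|Dev (c K.+1) (c K) w t|.
  by rewrite (dev_add v (c K.+1)); exact: ler_normD.
lra.
Qed.

Variables (p a s I ms eps : R) (j : nat) (w : Omega).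
Hypotheses (p1 : 1 <= p) (a0 : 0 < a) (I1 : 1 <= I) (eps0 : 0 < eps).
Hypothesis intI : (\int[leb]_t (wt (- 1 - a) t)%:E <= I%:E)%E.
Let q := 2 * p + a.
Hypothesis qs : q < s.
Let tau := q / s.
Hypothesis int_ms : (\int[mu]_x ((1 + enorm x) `^ s)%:E <= ms%:E)%E.
Hypothesis moments : n%:R^-1 * (\sum_(i < n) (1 + enorm (X i w)) `^ s) + ms <= expR j%:R.
Hypothesis big : 128 * (d%:R + 1) <= n%:R * eps ^+ 2.
Hypothesis good : forall k (m : link_index d (grid_size (R := R) d k).+1),
  (expdev dO Omega _ _ mu n X (fun x => dotp x (link_head d k _ m)) 
     (fun x => dotp x (link_tail d k _ m)) p a (rate eps tau k j) w
   <= (threshold I eps n%:R k j (link_cost d k _ m))%:E)%E.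

Let q1 : 1 <= q. Proof. by have := p1; have := a0; rewrite /q; lra. Qed.
Let q0 : 0 <= q. Proof. exact: le_trans q1. Qed.
Let s0 : 0 < s. Proof. by apply: le_lt_trans qs. Qed.
Let nn0 : 0 < n%:R :> R. Proof. by rewrite ltr0n. Qed.
Let one_le_enorm (x : d.-tuple R) : 1 <= 1 + enorm x.
Proof. by rewrite lerDl enorm_ge0. Qed.
Let E := expR (tau * j%:R).
Let e := expR (- j%:R) : R.
Let E0 : 0 < E. Proof. exact: expR_gt0. Qed.

Let mq := E * (1 + ms * e).

Let int_mq : (\int[mu]_x ((1 + enorm x) `^ q)%:E <= mq%:E)%E.
Proof.
apply: (@le_trans _ _ (\int[mu]_x (E%:E + (E * e)%:E * ((1 + enorm x) `^ s)%:E))%E).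
  apply: ge0_le_integral => //=.
  - by move=> x _; rewrite lee_fin powR_ge0.
  - by apply/measurable_EFinP; exact: measurable_powR_enorm.
  - apply: emeasurable_funD => //; apply: measurable_funeM.
    by apply/measurable_EFinP; exact: measurable_powR_enorm.
  - move=> x _; rewrite -EFinM -EFinD lee_fin.
    apply: (le_trans (powR_scale_le _ _ _ j (one_le_enorm x) q0 s0 (ltW qs))).
    by rewrite -/tau -/E -/e; rewrite mulrDr mulr1 -mulrA (mulrC e).
rewrite ge0_integralD//=; last 3 first.
- by move=> x _; rewrite lee_fin ltW.
- by move=> x _; rewrite -EFinM lee_fin !mulr_ge0 ?powR_ge0 ?expR_ge0.
- by apply: measurable_funeM; apply/measurable_EFinP; exact: measurable_powR_enorm.
rewrite integral_cst// [X in (_ * X + _)%E](_ : _ = 1%E) ?mule1; last exact: probability_setT.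
rewrite ge0_integralZl//; last 3 first.
- by apply/measurable_EFinP; exact: measurable_powR_enorm.
- by move=> x _; rewrite lee_fin powR_ge0.
- by rewrite lee_fin mulr_ge0 ?expR_ge0.
rewrite /mq mulrDr mulr1 EFinD leeD2lE// (mulrC ms) mulrA [leRHS]EFinM.
by rewrite lee_wpmul2l// lee_fin mulr_ge0 ?expR_ge0.
Qed.

(** In [powR_scale_le] the constant 1 is paid once for the sample and once for [mu]; by [moments]
    the two s-th moment terms, scaled by [expR (- j)], together cost only one more [n]. *)
Let sum_q : \sum_(i < n) (1 + enorm (X i w)) `^ q + n%:R * mq <= 3 * n%:R * E.
Proof.
set S := \sum_(i < n) (1 + enorm (X i w)) `^ s.
have h1 : \sum_(i < n) (1 + enorm (X i w)) `^ q <= E * (n%:R + S * e).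
  have -> : n%:R + S * e = \sum_(i < n) (1 + (1 + enorm (X i w)) `^ s * e).
    by rewrite big_split/= sumr_const card_ord mulr_suml.
  rewrite mulr_sumr; apply: ler_sum => i _.
  exact: (powR_scale_le _ _ _ j (one_le_enorm _) q0 s0 (ltW qs)).
have h2 : S * e + n%:R * (ms * e) <= n%:R.
  have hm : S + n%:R * ms <= n%:R * expR j%:R.
    by have := ler_wpM2l (ltW nn0) moments; rewrite mulrDr mulVKf ?gt_eqF.
  have := ler_wpM2r (ltW (expR_gt0 (- j%:R))) hm.
  by rewrite -/e mulrDl -!mulrA /e -expRD subrr expR0 mulr1.
apply: (le_trans (lerD h1 (lexx _))); rewrite /mq.
have -> : E * (n%:R + S * e) + n%:R * (E * (1 + ms * e)) = 
   E * (2 * n%:R + (S * e + n%:R * (ms * e))) by ring.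
rewrite (mulrC _ E) ler_pM2l//; lra.
Qed.

Let devvar_bound v v' (del : R) : 0 <= del -> enorm v <= 1 -> enorm v' <= 1 ->
  (forall x, `|dotp x v - dotp x v'| <= del * enorm x) ->
  (\int[leb]_t (wt (q - 1) t * Devvar v v' w t)%:E <= (del * (3 * n%:R * E))%:E)%E.
Proof.
move=> del0 v1 v'1 h.
apply: (le_trans (weighted_devvar_le _ _ _ _ mu n X _ _ (measurable_dotp v) (measurable_dotp v') 
   p a p1 a0 (@enorm R d) del mq w del0 measurable_enorm _ _ h int_mq)).
- by move=> x; apply: (le_trans (dotp_le _ _ _)); rewrite ler_piMr ?enorm_ge0.
- by move=> x; apply: (le_trans (dotp_le _ _ _)); rewrite ler_piMr ?enorm_ge0.
- by rewrite lee_fin ler_wpM2l// sum_q.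
Qed.

Let C := 13 + I * (2 * I + 4).
Let Ej : R := j.+1%:R * expR (tau * j%:R / 2).

Section direction.
Variable theta : d.-tuple R.
Hypothesis theta1 : enorm theta = 1.
Notation c := (chain d theta).

Let dev_link k : (\int[leb]_t (wt (p - 1) t * `|Dev (c k.+1) (c k) w t|)%:E <=
   (C * (n%:R * eps) * (k.+1%:R * 2 ^- k) * Ej)%:E)%E.
Proof.
have hW := link_cost_chain d d0 theta theta1 k.
have W0 := link_cost_gt0 d k _ (chain_link d theta k) : 0 < _ :> R.
have hB : (\int[leb]_t (wt (q - 1) t * Devvar (c k.+1) (c k) w t)%:E <= 
     (4 * 4 ^- k * (3 * n%:R * E))%:E)%E.
  apply: devvar_bound; rewrite ?enorm_chain// => x.
  exact: (dotp_chain d d0 theta theta1 x k).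
have := good k (chain_link d theta k); rewrite chain_head// chain_tail// => hg.
have z1 := threshold_ge1 I eps n%:R k j I1 nn0 _ (link_cost_ge1 d k _ (chain_link d theta k)).
have l0 := rate_gt0 eps tau k j eps0.
have := weighted_dev_le _ _ _ _ mu n X mX _ _ (measurable_dotp (c k.+1)) (measurable_dotp (c k))
   p a I intI _ _ _ w l0 z1 hg hB.
move/le_trans; apply; rewrite lee_fin.
exact: (level_bound I eps n%:R d%:R tau k j I1 eps0 nn0 (ler0n _ _) big _ W0 hW).
Qed.

(** No random event is needed: the deviation is at most its bracket and [wt (p - 1) <= wt (q - 1)],
    so the approximation error of the direction suffices. *)
Let dev_remainder K : (\int[leb]_t (wt (p - 1) t * `|Dev theta (c K.+1) w t|)%:E <=
   (4 ^- K * (3 * n%:R * E))%:E)%E.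
Proof.
apply: le_trans (devvar_bound theta (c K.+1) _ _ _ _ _); first last.
- by move=> x; exact: dotp_chain_theta.
- exact: enorm_chain.
- by rewrite theta1.
- by rewrite invr_ge0 exprn_ge0.
have pq : p - 1 <= q - 1 by have := p1; have := a0; rewrite /q; lra.
apply: ge0_le_integral => //=.
- by move=> t _; rewrite lee_fin mulr_ge0 ?wt_ge0.
- apply/measurable_EFinP; apply: measurable_funM; first exact: measurable_wt.
  apply: measurableT_comp => //; apply: (measurable_dev2 _ _ _ _ mu n X mX _ _ _ _ _ _ (cst w) id) => //; exact: measurable_dotp.
- apply/measurable_EFinP; apply: measurable_funM; first exact: measurable_wt.
  apply: (measurable_devvar2 _ _ _ _ mu n X mX _ _ _ _ _ _ (cst w) id) => //; exact: measurable_dotp.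
- move=> t _; rewrite lee_fin; apply: ler_pM; rewrite ?wt_ge0//.
    by rewrite /wt ler_powR// lerDl.
  by apply: normr_dev_le; exact: measurable_dotp.
Qed.

Lemma dev_direction_le :
  (\int[leb]_t (wt (p - 1) t * `|Dev theta (c 0) w t|)%:E <= (4 * C * (n%:R * eps) * Ej)%:E)%E.
Proof.
have md v v' : measurable_fun (setT : set Z) (fun t => (wt (p - 1) t * `|Dev v v' w t|)%:E).
  apply/measurable_EFinP; apply: measurable_funM; first exact: measurable_wt.
  apply: measurableT_comp => //; apply: (measurable_dev2 _ _ _ _ mu n X mX _ _ _ _ _ _ (cst w) id) => //; exact: measurable_dotp.
have d_ge0 v v' t : (0 <= (wt (p - 1) t * `|Dev v v' w t|)%:E)%E.
  by rewrite lee_fin mulr_ge0 ?wt_ge0.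
apply/lee_addgt0Pr => x x0.
set B := 3 * n%:R * E.
have B0 : 0 < B by rewrite !mulr_gt0.
(* The chain is cut at a depth depending on the slack [x], using [K < 4 ^ K]; the bound on the links
   is uniform in [K]. *)
pose K := (Num.truncn (B / x)).+1.
have hK : 4 ^- K * B <= x.
  rewrite mulrC ler_pdivrMr ?exprn_gt0// mulrC -ler_pdivrMr//.
  apply: (le_trans (ltW (truncnS_gt _))); rewrite -natrX ler_nat -/K.
  by apply: ltnW; exact: ltn_expl.
apply: (@le_trans _ _ (\int[leb]_t ((wt (p - 1) t * `|Dev theta (c K.+1) w t|)%:E + 
   \sum_(k < K.+1) (wt (p - 1) t * `|Dev (c k.+1) (c k) w t|)%:E))%E).
  apply: ge0_le_integral => //=.
  - apply: emeasurable_funD => //; apply: emeasurable_sum => k; exact: md.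
  - move=> t _; rewrite sumEFin -EFinD lee_fin -mulr_sumr -mulrDr ler_wpM2l ?wt_ge0//.
    exact: normr_dev_chain_le.
rewrite ge0_integralD//; last 2 first.
- by move=> t _; apply: sume_ge0 => k _; exact: d_ge0.
- by apply: emeasurable_sum => k; exact: md.
rewrite addeC; apply: leeD; last first.
  by apply: (le_trans (dev_remainder K)); rewrite lee_fin.
rewrite ge0_integral_sum//.
apply: (@le_trans _ _ (\sum_(k < K.+1) (C * (n%:R * eps) * (k.+1%:R * 2 ^- k) * Ej)%:E)%E).
  by apply: lee_sum => k _; exact: dev_link.
rewrite sumEFin lee_fin -mulr_suml -mulr_sumr.
have Ej0 : 0 <= Ej by rewrite mulr_ge0 ?expR_ge0.
have C0 : 0 <= C by have := I1; rewrite /C => ?; rewrite addr_ge0// mulr_ge0; lra.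
rewrite ler_wpM2r// [leLHS]mulrC -[leRHS]mulrA ler_wpM2r ?mulr_ge0 ?(ltW eps0)//.
exact: sum_succ_half_pow.
Qed.

End direction.
End good_sample.

(** * Probability of the bad event *)

Section bad_event.
Context {R : realType} dO (Omega : measurableType dO) (P : probability Omega R) (d : nat).
Variables (mu : probability (d.-tuple R) R) (n : nat) (X : nat -> Omega -> d.-tuple R).
Hypothesis mX : forall j, (j < n)%N -> measurable_fun setT (X j).
Hypothesis lawX : forall j, (j < n)%N -> forall B, measurable B -> P (X j @^-1` B) = mu B.
Hypothesis indepX : mutually_independent P n X.
Variables (p a I eps tau : R).
Hypothesis I1 : 1 <= I.
Hypothesis intI : (\int[@lebesgue_measure R]_t (wt (- 1 - a) t)%:E <= I%:E)%E.

Definition bad_link (k j : nat) (m : link_index d (grid_size (R := R) d k).+1) : set Omega :=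
  [set w | ((threshold I eps n%:R k j (link_cost d k _ m))%:E < 
    expdev dO Omega _ _ mu n X (fun x => dotp x (link_head d k _ m)) 
     (fun x => dotp x (link_tail d k _ m)) p a (rate eps tau k j) w)%E].

(** A countable union of measurable events that does not involve the direction or the size of the
    sample's moments. *)
Definition bad_event : set Omega :=
  \bigcup_k \bigcup_j \big[setU/set0]_m bad_link k j m.

Let b := expR (- (n%:R * eps ^+ 2) / 2).

Let thr_gt0 k j W : 0 < W -> 0 < threshold I eps n%:R k j W.
Proof.
by move=> W0; rewrite /threshold !mulr_gt0 ?expR_gt0 ?exprn_gt0// (lt_le_trans _ I1).
Qed.

Let bad_linkP k j m : measurable (bad_link k j m) /\ 
  (P (bad_link k j m) <= (b / 2 ^+ k.+1 / 2 ^+ j.+1 * (link_cost d k _ m)^-1)%:E)%E.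
Proof.
have W0 := link_cost_gt0 d k _ m : 0 < _ :> R.
have [mB hB] := expdev_tail _ _ P _ _ mu n X mX lawX indepX _ _ (measurable_dotp _ (link_head d k _ m))
  (measurable_dotp _ (link_tail d k _ m)) p a I intI (rate eps tau k j) _ (thr_gt0 k j _ W0).
split=> //; apply: (le_trans hB); rewrite lee_fin le_eqVlt; apply/orP; left; apply/eqP.
have I0 : 0 < I by apply: lt_le_trans I1.
rewrite /threshold /b mulNr expRN; field.
by rewrite !gt_eqF ?exprn_gt0 ?expR_gt0.
Qed.

Let bad_levelP k j : measurable (\big[setU/set0]_m bad_link k j m) /\
  (P (\big[setU/set0]_m bad_link k j m) <= (b / 2 ^+ k.+1 / 2 ^+ j.+1)%:E)%E.
Proof.
split; first by apply: bigsetU_measurable => m _; have [] := bad_linkP k j m.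
apply: (@le_trans _ _ (\sum_m P (bad_link k j m))%E).
  by apply: measure_bigsetU_le => m; have [] := bad_linkP k j m.
apply: (@le_trans _ _ (\sum_m (b / 2 ^+ k.+1 / 2 ^+ j.+1 * (link_cost d k _ m)^-1)%:E)%E).
  by apply: lee_sum => m _; have [] := bad_linkP k j m.
rewrite sumEFin lee_fin -mulr_sumr ler_piMr ?sum_link_cost//.
by rewrite !mulr_ge0 ?expR_ge0 ?invr_ge0 ?exprn_ge0.
Qed.

Lemma measurable_bad_event : measurable bad_event.
Proof.
apply: bigcup_measurable => k _; apply: bigcup_measurable => j _.
by have [] := bad_levelP k j.
Qed.

Lemma probability_bad_event : (P bad_event <= b%:E)%E.
Proof.
apply: measure_bigcup_geometric => [|k|k]; first exact: expR_ge0.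
  by apply: bigcup_measurable => j _; have [] := bad_levelP k j.
apply: measure_bigcup_geometric => [|j|j]; first by rewrite mulr_ge0 ?expR_ge0// invr_ge0 exprn_ge0.
  by have [] := bad_levelP k j.
by have [] := bad_levelP k j.
Qed.

Lemma not_bad_event w : ~ bad_event w -> forall k j (m : link_index d (grid_size (R := R) d k).+1),
  (expdev dO Omega _ _ mu n X (fun x => dotp x (link_head d k _ m)) 
     (fun x => dotp x (link_tail d k _ m)) p a (rate eps tau k j) w
   <= (threshold I eps n%:R k j (link_cost d k _ m))%:E)%E.
Proof.
move=> nb k j m; rewrite leNgt; apply/negP => h; apply: nb.
by exists k => //; exists j => //; rewrite (bigD1 m)//=; left.
Qed.

End bad_event.

(** * Empirical measures *)

Section empirical_measure.
Context {R : realType} (d : nat) (pts : nat -> d.-tuple R) (n : nat).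
Hypothesis n0 : (0 < n)%N.

Lemma empiricalE (A : set (d.-tuple R)) :
  empirical pts n A = (n%:R^-1 * \sum_(i < n) \1_A (pts i))%:E.
Proof.
by rewrite /empirical /mscale/= /msum EFinM -sumEFin.
Qed.

Lemma empirical_setT : empirical pts n setT = 1%E.
Proof.
rewrite empiricalE; congr EFin.
under eq_bigr do rewrite indicE in_setT.
by rewrite sumr_const card_ord mulVf// pnatr_eq0 -lt0n.
Qed.

Lemma integral_empirical (f : d.-tuple R -> R) : measurable_fun setT f -> (forall x, 0 <= f x) ->
  (\int[empirical pts n]_x (f x)%:E = (n%:R^-1 * \sum_(i < n) f (pts i))%:E)%E.
Proof.
move=> mf f0; have mf' : measurable_fun setT (EFin \o f) by exact/measurable_EFinP.
rewrite /empirical ge0_integral_mscale//; last by move=> x _; rewrite lee_fin.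
rewrite ge0_integral_measure_sum//; last by move=> x _; rewrite lee_fin.
rewrite EFinM -sumEFin; congr (_ * _)%E; apply: eq_bigr => i _.
by rewrite integral_dirac// diracT mul1e.
Qed.

End empirical_measure.

Section mass_one.
Context {R : realType} dT (T : measurableType dT) (m : {measure set T -> \bar R}).
Hypothesis mT : m setT = 1%E.

(** An empirical measure has mass one only when [n] is positive, so the probability structure is
    attached to a copy carrying the proof of that fact. *)
Definition mass_one_probability of m setT = 1%E : set T -> \bar R := m.

HB.instance Definition _ := Measure.on (mass_one_probability mT).
HB.instance Definition _ :=
  @Measure_isProbability.Build _ _ R (mass_one_probability mT) mT.

End mass_one.

(** * From distribution functions to the max-sliced distance *)

Section sliced_transport.
Context {R : realType} (d : nat).

Lemma Wp_le_cdf (p K : R) (m1 m2 : {measure set (d.-tuple R) -> \bar R}) (theta : d.-tuple R) :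
  1 <= p -> m1 setT = 1%E -> m2 setT = 1%E ->
  (\int[@lebesgue_measure R]_t (wt (p - 1) t * 
     `|cdfR (Defs.proj m1 theta) t - cdfR (Defs.proj m2 theta) t|)%:E <= K%:E)%E ->
  (Wp p (Defs.proj m1 theta) (Defs.proj m2 theta) <= ((4 `^ p * K) `^ p^-1)%:E)%E.
Proof.
move=> p1 m1T m2T hK.
have p0 : 0 < p by apply: lt_le_trans p1.
pose f (x : d.-tuple R) : measurableTypeR R := dotp x theta.
have mf : measurable_fun setT f by exact: measurable_dotp.
pose fM : {mfun (d.-tuple R : measurableType _) >-> measurableTypeR R} :=
  HB.pack f (isMeasurableFun.Build _ _ _ _ _ mf).
pose P1 : probability (d.-tuple R) R := mass_one_probability _ _ m1 m1T.
pose P2 : probability (d.-tuple R) R := mass_one_probability _ _ m2 m2T.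
have [pi cpi hpi] := transport_cost_le_cdf p (distribution P1 fM) (distribution P2 fM) p1.
have c4 : (0 <= (4 `^ p)%:E)%E by rewrite lee_fin powR_ge0.
have hpi' : (\int[pi]_z (`|z.1 - z.2| `^ p)%:E <= (4 `^ p * K)%:E)%E.
  by apply: (le_trans hpi); rewrite EFinM lee_wpmul2l.
rewrite /Wp -poweR_EFin; apply: gt0_ler_poweR.
- by rewrite invr_ge0 ltW.
- rewrite in_itv/= leey andbT; apply: le_ereal_inf_tmp => _ [nu _ <-].
  by apply: integral_ge0 => z _; rewrite lee_fin powR_ge0.
- rewrite in_itv/= leey andbT; apply: le_trans hpi'.
  by apply: integral_ge0 => z _; rewrite lee_fin powR_ge0.
by apply: le_trans hpi'; apply: ereal_inf_lbound; exists pi.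
Qed.

Lemma maxslicedWp_powR_le (p K : R) (m1 m2 : {measure set (d.-tuple R) -> \bar R}) :
  1 <= p -> 0 <= K -> m1 setT = 1%E -> m2 setT = 1%E ->
  (forall theta, enorm theta = 1 -> (\int[@lebesgue_measure R]_t (wt (p - 1) t * 
     `|cdfR (Defs.proj m1 theta) t - cdfR (Defs.proj m2 theta) t|)%:E <= K%:E)%E) ->
  (maxslicedWp p m1 m2 `^ p <= (4 `^ p * K)%:E)%E.
Proof.
move=> p1 K0 m1T m2T hK.
have p0 : 0 < p by apply: lt_le_trans p1.
have K4 : 0 <= 4 `^ p * K by rewrite mulr_ge0 ?powR_ge0.
have -> : (4 `^ p * K)%:E = (((4 `^ p * K) `^ p^-1)%:E `^ p)%E.
  by rewrite poweR_EFin -powRrM mulVf ?gt_eqF// powRr1.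
have hs : (maxslicedWp p m1 m2 <= ((4 `^ p * K) `^ p^-1)%:E)%E.
  by apply: ge_ereal_sup => _ [theta /= h1 <-]; apply: Wp_le_cdf => //; exact: hK.
have W0 theta : (0 <= Wp p (Defs.proj m1 theta) (Defs.proj m2 theta))%E by exact: poweR_ge0.
(* Without unit vectors the supremum is [-oo], whose power with positive exponent is 0 by
   convention. *)
have [[theta theta1]|no] := pselect (exists theta : d.-tuple R, enorm theta = 1).
  apply: gt0_ler_poweR => //; rewrite ?in_itv/= ?leey ?andbT ?lee_fin ?powR_ge0 ?(ltW p0)//.
  by apply: (le_trans (W0 theta)); apply: ereal_sup_ubound; exists theta.
have -> : maxslicedWp p m1 m2 = -oo%E.
  rewrite /maxslicedWp (_ : [set _ | _ in _] = set0) ?ereal_sup0//.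
  by apply/seteqP; split => // x [theta /= h _]; apply: no; exists theta.
by rewrite poweRNyr ?gt_eqF// poweR_ge0.
Qed.

End sliced_transport.

(** * Choice of the slice and of the constant *)

Section final_constants.
Context {R : realType}.

Lemma powR_1D_le (x s : R) : 0 <= x -> 0 <= s -> (1 + x) `^ s <= 2 `^ s * (1 + x `^ s).
Proof.
move=> x0 s0; have [x1|x1] := leP x 1.
  apply: (@le_trans _ _ (2 `^ s)).
    by apply: ge0_ler_powR; rewrite ?nnegrE//; lra.
  by rewrite ler_peMr ?powR_ge0// lerDl powR_ge0.
apply: (@le_trans _ _ ((2 * x) `^ s)).
  by apply: ge0_ler_powR; rewrite ?nnegrE//; lra.
by rewrite powRM// ler_wpM2l ?powR_ge0// lerDr.
Qed.

Lemma exists_exp_bracket (N : R) : 1 <= N ->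
  exists j : nat, N <= expR j%:R /\ expR j%:R <= expR 1 * N.
Proof.
move=> N1; have N0 : 0 < N by apply: lt_le_trans N1.
have l0 : 0 <= ln N by rewrite ln_ge0.
exists (Num.truncn (ln N)).+1; have /andP[h1 h2] := truncn_itv l0; split.
  by rewrite -[leLHS](lnK (_ : N \is Num.pos)) ?posrE// ler_expR ltW.
rewrite -[in leRHS](lnK (_ : N \is Num.pos)) ?posrE// -expRD ler_expR.
by rewrite -natr1 addrC lerD2l.
Qed.

(** This is where the factor [1 + Num.sqrt m] of the theorem arises. *)
Lemma expR_half_le (j : nat) (K m : R) : 0 <= K -> 0 <= m -> expR j%:R <= K * (1 + m) ->
  expR (j%:R / 2) <= Num.sqrt K * (1 + Num.sqrt m).
Proof.
move=> K0 m0 h.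
have -> : expR (j%:R / 2) = Num.sqrt (expR j%:R) :> R.
  have -> : expR j%:R = expR (j%:R / 2) ^+ 2 :> R.
    by rewrite expr2 -expRD; congr expR; field.
  by rewrite sqrtr_sqr ger0_norm ?expR_ge0.
apply: (le_trans (ler_wsqrtr h)); rewrite sqrtrM// ler_wpM2l ?sqrtr_ge0//.
rewrite -[leRHS]ger0_norm ?addr_ge0 ?sqrtr_ge0// -sqrtr_sqr ler_wsqrtr//.
rewrite sqrrD sqr_sqrtr// expr1n mul1r; have := sqrtr_ge0 m; lra.
Qed.

End final_constants.

Theorem theorem3p1 (R : realType) (p s : R) :
  1 <= p -> 2 * p < s ->
  exists c : R, 0 < c /\
  forall (d : nat) (mu : probability (d.-tuple R) R)
         (dO : measure_display) (Omega : measurableType dO) (P : probability Omega R)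
         (n : nat) (X : nat -> Omega -> d.-tuple R),
    (1 <= d)%N -> (1 <= n)%N ->
    (moment mu s < +oo)%E ->
    (forall j, (j < n)%N -> measurable_fun setT (X j)) ->
    (forall j, (j < n)%N -> forall B, measurable B -> P (X j @^-1` B) = mu B) ->
    mutually_independent P n X ->
    forall eps : R, 0 < eps ->
    exists2 E : set Omega, measurable E /\
      [set w | (maxslicedWp p (empirical (fun j => X j w) n) mu `^ p >=
                ((c * ln (2 * n%:R + 1) `^ (p / s)) *
                 (Num.sqrt (d%:R / n%:R) +
                  (1 + Num.sqrt (Num.max (fine (moment mu s))
                                         (fine (moment (empirical (fun j => X j w) n) s))))
                  * eps))%:E)%E] `<=` E
    & (P E <= (expR (- (n%:R * eps ^+ 2) / 2) +
               8 * expR (ln (2 * n%:R + 1) * (2 * (d%:R + 1) - n%:R * eps ^+ 2 / 64)))%:E)%E.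
Proof.
move=> p1 ps.
(* [q] is the midpoint of [2 * p] and [s]: both [0 < a] and [tau < 1] are needed. *)
pose a := (s - 2 * p) / 2; pose q := 2 * p + a; pose tau := q / s.
have a0 : 0 < a by rewrite /a; lra.
have qs : q < s by rewrite /q /a; lra.
have s0 : 0 < s by lra.
have q0 : 0 < q by rewrite /q; lra.
have tau01 : 0 < tau < 1 by rewrite divr_gt0//= ltr_pdivrMr ?mul1r.
have [I I1 intI] := integral_wt_bounded a a0.
pose C := 4 * (13 + I * (2 * I + 4)).
(* The first factor comes from absorbing [j.+1]. Under the root, [expR 1] is lost by rounding the
   logarithm of the moments up to an integer, and the rest by passing from the norm to 1 plus the
   norm for two moments. *)
pose D := 2 / (1 - tau) * Num.sqrt (expR 1 * (2 * 2 `^ s)).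
have C0 : 0 < C by rewrite mulr_gt0// addr_gt0// mulr_gt0; lra.
have D0 : 0 <= D.
  have /andP[_ t1] := tau01.
  by rewrite mulr_ge0 ?sqrtr_ge0// divr_ge0// subr_ge0 ltW.
have CD0 : 0 <= 4 `^ p * (C * D) by rewrite mulr_ge0 ?powR_ge0// mulr_ge0// ltW.
have l3 : 0 < ln 3 :> R by rewrite ln_gt0// ltr1n.
have k0 : 0 < ln 3 `^ (p / s) :> R by rewrite powR_gt0.
(* Since [ln (2 * n + 1)] is at least [ln 3], the division gives a bound uniform in [n]. The added 1
   makes the final comparison strict, as the event is defined by a non-strict inequality. *)
pose c := (4 `^ p * (C * D) + 1) / ln 3 `^ (p / s).
have c0 : 0 < c by rewrite divr_gt0// ltr_wpDl.
exists c; split=> // d mu dO Omega P n X d0 n0 momfin mX lawX indepX eps eps0.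
set L := ln (2 * n%:R + 1).
have nn1 : 1 <= n%:R :> R by rewrite ler1n.
have nn0 : 0 < n%:R :> R by lra.
have L3 : ln 3 <= L by rewrite /L ler_ln ?posrE//; lra.
(* At [128 = 2 * 64] the bracket in the second exponential changes sign. *)
have [big|small] := leP (128 * (d%:R + 1)) (n%:R * eps ^+ 2); last first.
  exists setT; first by split.
  rewrite probability_setT lee_fin; apply: ler_wpDl; first exact: expR_ge0.
  apply: (@le_trans _ _ (8 * expR 0)); first by rewrite expR0; lra.
  by rewrite ler_pM2l// ler_expR mulr_ge0//; lra.
exists (bad_event _ _ d mu n X p a I eps tau); last first.
  apply: (le_trans (probability_bad_event _ _ P d mu n X mX lawX indepX p a I eps tau I1 intI)).
  by rewrite lee_fin lerDl mulr_ge0 ?expR_ge0.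
split; first exact: (measurable_bad_event _ _ P d mu n X mX lawX indepX p a I eps tau I1 intI).
move=> w /= hw; apply: contrapT => nbad.
have good := not_bad_event _ _ d mu n X p a I eps tau w nbad.
pose pts j := X j w.
set Mn := fine (moment (empirical pts n) s) in hw *; set M := fine (moment mu s) in hw *.
have M0 : 0 <= M by rewrite fine_ge0// integral_ge0// => x _; rewrite lee_fin powR_ge0.
have mpow : measurable_fun setT (fun x : d.-tuple R => enorm x `^ s).
  by apply: (measurableT_comp (measurable_powR _)); exact: measurable_enorm.
have MnE : Mn = n%:R^-1 * \sum_(i < n) enorm (X i w) `^ s.
  by rewrite /Mn /moment integral_empirical// => x; exact: powR_ge0.
have Mn0 : 0 <= Mn by rewrite MnE mulr_ge0 ?invr_ge0// sumr_ge0// => i _; exact: powR_ge0.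
set mx := Num.max M Mn in hw *.
have [Mmx Mnmx] : M <= mx /\ Mn <= mx by rewrite /mx !le_max !lexx orbT.
have mx0 : 0 <= mx by exact: le_trans Mmx.
pose ms := 2 `^ s * (1 + M).
have t0 : 0 < 2 `^ s :> R by rewrite powR_gt0.
have int_ms : (\int[mu]_x ((1 + enorm x) `^ s)%:E <= ms%:E)%E.
  apply: (@le_trans _ _ (\int[mu]_x ((2 `^ s)%:E * (1%:E + (enorm x `^ s)%:E)))%E).
    apply: ge0_le_integral => //=.
    - by move=> x _; rewrite lee_fin powR_ge0.
    - by apply/measurable_EFinP; exact: measurable_powR_enorm.
    - apply: measurable_funeM; apply: emeasurable_funD => //; exact/measurable_EFinP.
    - by move=> x _; rewrite -EFinD -EFinM lee_fin powR_1D_le ?enorm_ge0// ltW.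
  rewrite ge0_integralZl//; last 2 first.
  - by apply: emeasurable_funD => //; exact/measurable_EFinP.
  - by move=> x _; rewrite -EFinD lee_fin addr_ge0 ?powR_ge0.
  rewrite ge0_integralD//; last 2 first.
  - by move=> x _; rewrite lee_fin powR_ge0.
  - exact/measurable_EFinP.
  rewrite integral_cst// [X in (_ * X + _)%E](_ : _ = 1%E) ?mule1; last exact: probability_setT.
  rewrite /ms [leRHS]EFinM EFinD /M fineK// ge0_fin_numE//.
  by apply: integral_ge0 => x _; rewrite lee_fin powR_ge0.
pose N := 2 * 2 `^ s * (1 + mx).
have [j [Nj jN]] : exists j : nat, N <= expR j%:R /\ expR j%:R <= expR 1 * N.
  apply: exists_exp_bracket; rewrite /N.
  have : 1 <= 2 `^ s :> R by rewrite -[leLHS](powRr0 2) ler_powR ?ler1n// ltW.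
  by move=> t1; rewrite mulr_ege1 ?lerDl// mulr_ege1// ler1n.
have moms : n%:R^-1 * (\sum_(i < n) (1 + enorm (X i w)) `^ s) + ms <= expR j%:R.
  apply: le_trans Nj.
  have h : n%:R^-1 * (\sum_(i < n) (1 + enorm (X i w)) `^ s) <= 2 `^ s * (1 + Mn).
    have -> : 2 `^ s * (1 + Mn) = n%:R^-1 * \sum_(i < n) (2 `^ s * (1 + enorm (X i w) `^ s)).
      rewrite MnE -mulr_sumr big_split/= sumr_const card_ord.
      by field; rewrite gt_eqF.
    rewrite ler_wpM2l ?invr_ge0//; apply: ler_sum => i _.
    by rewrite powR_1D_le ?enorm_ge0// ltW.
  rewrite /N /ms; nra.
have key theta : enorm theta = 1 -> 
   (\int[@lebesgue_measure R]_t (wt (p - 1) t * 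
     `|cdfR (Defs.proj (empirical pts n) theta) t - cdfR (Defs.proj mu theta) t|)%:E <= 
   (C * (D * ((1 + Num.sqrt mx) * eps)))%:E)%E.
  move=> theta1.
  have hdev := dev_direction_le _ _ d mu n X d0 n0 mX p a s I ms eps j w p1 a0 I1 eps0 intI qs
    int_ms moms big (fun k m => good k j m) theta theta1.
  pose Dev := dev _ _ _ _ mu n X (fun x => dotp x theta) (fun x => dotp x (chain d theta 0)) w.
  have cdf_mu t : cdfR (Defs.proj mu theta) t = fine (mu ((fun x => dotp x theta) @^-1` `]-oo, t]%classic)).
    by [].
  have cdf_emp t : cdfR (Defs.proj (empirical pts n) theta) t =
      n%:R^-1 * \sum_(i < n) below (dotp (X i w) theta) t.
    rewrite /cdfR /Defs.proj /pushforward empiricalE/=; congr (_ * _); apply: eq_bigr => i _.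
    rewrite /below indicE; congr (_%:R); congr nat_of_bool.
    by apply/idP/idP; rewrite inE/= in_itv.
  have chain0 x : dotp x (chain d theta 0) = 0.
    by rewrite /dotp big1// => i _; rewrite tnth_mktuple mulr0.
  have cdf0 t : fine (mu ((fun x => dotp x (chain d theta 0)) @^-1` `]-oo, t]%classic)) = below 0 t.
    rewrite /below; case: (leP 0 t) => t0'.
      rewrite (_ : _ @^-1` _ = setT) ?probability_setT//.
      by apply/seteqP; split => // x _ /=; rewrite chain0 in_itv.
    rewrite (_ : _ @^-1` _ = set0) ?measure0//.
    by apply/seteqP; split => // x /=; rewrite chain0 in_itv/= leNgt t0'.
  (* The start of the chain contributes [below 0 t] to the sample sum and to the mean alike, so it
     cancels. *)
  have devE t : cdfR (Defs.proj (empirical pts n) theta) t - cdfR (Defs.proj mu theta) t =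
      n%:R^-1 * Dev t.
    rewrite cdf_emp cdf_mu /Dev /dev /jump /jump_mean cdf0.
    under [in RHS]eq_bigr do rewrite chain0.
    rewrite sumrB sumr_const card_ord -[_ *+ n]mulr_natl.
    by field; rewrite gt_eqF.
  under eq_integral do rewrite devE normrM ger0_norm ?invr_ge0// mulrCA EFinM.
  rewrite ge0_integralZl//; last 2 first.
  - apply/measurable_EFinP; apply: measurable_funM; first exact: measurable_wt.
    apply: measurableT_comp => //.
    by apply: (measurable_dev2 _ _ _ _ mu n X mX _ _ _ _ _ _ (cst w) id) => //; exact: measurable_dotp.
  - by move=> t _; rewrite lee_fin mulr_ge0 ?wt_ge0.
  apply: (@le_trans _ _ (n%:R^-1%:E * (C * (n%:R * eps) * 
      (j.+1%:R * expR (tau * j%:R / 2)))%:E)%E).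
    by rewrite lee_wpmul2l// lee_fin invr_ge0.
  rewrite -EFinM lee_fin.
  have -> : n%:R^-1 * (C * (n%:R * eps) * (j.+1%:R * expR (tau * j%:R / 2))) =
      C * (j.+1%:R * expR (tau * j%:R / 2) * eps).
    by field; rewrite gt_eqF.
  rewrite ler_pM2l// mulrA ler_pM2r//.
  apply: (le_trans (natr_expR_le j tau tau01)); rewrite /D -[leRHS]mulrA ler_wpM2l//.
    by rewrite divr_ge0// subr_ge0 ltW//; case/andP: tau01.
  apply: expR_half_le => //.
  by rewrite -mulrA.
have := maxslicedWp_powR_le _ p _ (empirical pts n) mu p1 _ (empirical_setT _ _ _ n0) (probability_setT mu) key.
have B0 : 0 < (1 + Num.sqrt mx) * eps by rewrite mulr_gt0// ltr_pwDl// sqrtr_ge0.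
move=> /(_ (mulr_ge0 (ltW C0) (mulr_ge0 D0 (ltW B0)))) hW.
have := le_trans hw hW; rewrite lee_fin leNgt => /negP; apply.
have cL : 4 `^ p * (C * D) + 1 <= c * L `^ (p / s).
  rewrite /c [leRHS]mulrAC ler_pdivlMr// ler_wpM2l ?addr_ge0//.
  apply: ge0_ler_powR => //; rewrite ?nnegrE ?divr_ge0 ?(ltW s0)//; lra.
set B := (1 + Num.sqrt mx) * eps in B0 *.
have -> : 4 `^ p * (C * (D * B)) = 4 `^ p * (C * D) * B by ring.
apply: (@lt_le_trans _ _ ((4 `^ p * (C * D) + 1) * B)); first by rewrite ltr_pM2r// ltrDl.
apply: ler_pM; rewrite ?addr_ge0 ?(ltW B0)//.
by rewrite lerDr sqrtr_ge0.
Qed.
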